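(* On every monotonically growing temporal tree $\mathcal{T}$ with $n$ vertices, a Nash equilibrium in the two-player temporal Voronoi game $\mathrm{Vor}(\mathcal{T},2)$ exists and can be found in $\mathcal{O}(n^2)$ time.
   Context: A temporal graph $\mathcal{G}=(V,(E_t)_{t=1}^\infty)$ consists of a finite vertex set $V$ and edge sets $E_t\subseteq\binom{V}{2}$; it is assumed to have finite lifetime, i.e. there is $\tau$ with $E_t=E_\tau$ for all $t\ge\tau$. The underlying graph is $(V,\bigcup_t E_t)$. A temporal tree is a temporal graph whose underlying graph is a tree. $\mathcal{G}$ is monotonically growing if $E_t\subseteq E_{t+1}$ for all $t$. A temporal walk from $v_0$ to $v_d$ is a sequence $(\{v_0,v_1\},t_1),\dots,(\{v_{d-1},v_d\},t_d)$ with $t_1<t_2<\dots<t_d$ and $\{v_{i-1},v_i\}\in E_{t_i}$ for all $i$; its arrival time is $t_d$. $\mathrm{td}(u,v)$ is the smallest arrival time of a temporal walk from $u$ to $v$ ($\infty$ if none exists, and $\mathrm{td}(v,v)=0$). Two-player temporal Voronoi game $\mathrm{Vor}(\mathcal{G},2)$: players $1,2$ choose vertices $p_1,p_2\in V$ simultaneously. The payoff of player $i$ is the number of vertices $v$ with $\mathrm{td}(p_i,v)<\mathrm{td}(p_j,v)$, where $j\ne i$ is the other player. A profile $(p_1,p_2)$ is a Nash equilibrium if no player can strictly increase her payoff by unilaterally choosing another vertex. For the running time it is assumed that the first appearance time of any edge can be looked up in constant time. *)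

(* Defs.v *)
From mathcomp Require Import all_boot.
From mathcomp Require Import boolp.

Set Implicit Arguments.
Unset Strict Implicit.
Unset Printing Implicit Defensive.

(* Time steps are 1, 2, ...; [layer t] is E_t, and index 0 is a dummy that
   carries no edge. *)
Record temporal_graph (V : finType) := TemporalGraph {
  layer : nat -> {set {set V}};
  layer_pairs : forall t e, e \in layer t -> #|e| = 2;
  layer0 : layer 0 = set0;
  finite_lifetime :
    exists tau, 0 < tau /\ forall t, tau <= t -> layer t = layer tau
}.

Definition underlying (V : finType) (G : temporal_graph V) : rel V :=
  fun u v => `[< exists t, [set u; v] \in layer G t >].

Definition is_tree (V : finType) (e : rel V) : Prop :=
  [/\ 0 < #|V|,
      forall u v, connect e u v
    & forall c : seq V, ucycle e c -> size c < 3].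

Definition temporal_tree (V : finType) (G : temporal_graph V) : Prop :=
  is_tree (underlying G).

Definition monotonically_growing (V : finType) (G : temporal_graph V) : Prop :=
  forall t, 0 < t -> layer G t \subset layer G t.+1.

(* The walk ({v_0,v_1},t_1), ..., ({v_(d-1),v_d},t_d) is represented by its
   start v_0 and the sequence w = [:: (v_1,t_1); ...; (v_d,t_d)]. *)
Definition temporal_walk (V : finType) (G : temporal_graph V)
    (u : V) (w : seq (V * nat)) : bool :=
  path (fun x y => (x.2 < y.2) && ([set x.1; y.1] \in layer G y.2)) (u, 0) w.

(* The empty walk arrives at its start at time 0, so that td v v = Some 0. *)
Definition arrives (V : finType) (G : temporal_graph V) (u v : V) (t : nat)
    : bool :=
  `[< exists w, temporal_walk G u w /\ last (u, 0) w = (v, t) >].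

(* [None] stands for infinity. *)
Definition td (V : finType) (G : temporal_graph V) (u v : V) : option nat :=
  if pselect (exists t, arrives G u v t) is left h then Some (ex_minn h)
  else None.

Definition td_lt (x y : option nat) : bool :=
  match x, y with
  | Some a, Some b => a < b
  | Some _, None => true
  | None, _ => false
  end.

(* Payoff of the player who chose [p] when the other player chose [q]. *)
Definition payoff (V : finType) (G : temporal_graph V) (p q : V) : nat :=
  #|[set v | td_lt (td G p v) (td G q v)]|.

Definition nash_equilibrium (V : finType) (G : temporal_graph V) (p1 p2 : V)
    : Prop :=
  (forall q, payoff G q p2 <= payoff G p1 p2) /\
  (forall q, payoff G q p1 <= payoff G p2 p1).

(* A uniform-cost random access machine with structured control flow.  The
   memory consists of infinite arrays of naturals, indexed by naturals.  Array
   names are literals, so that a program uses only a fixed number of arrays;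
   a scalar variable is cell 0 of an array.  [ESub] is truncated subtraction
   (hence a < b iff b - a is nonzero); there is no multiplication.  [ELookup]
   is the constant-time lookup of the first appearance time of an edge. *)
Inductive expr : Type :=
| EConst of nat
| EGet of nat & expr
| EAdd of expr & expr
| ESub of expr & expr
| ELookup of expr & expr.

Inductive cmd : Type :=
| CSkip
| CSet of nat & expr & expr    (* CSet a i e is a[i] := e *)
| CSeq of cmd & cmd
| CIf of expr & cmd & cmd      (* a guard holds iff its value is nonzero *)
| CWhile of expr & cmd.

Definition store := nat -> nat -> nat.

Definition update (s : store) (a i x : nat) : store :=
  fun b j => if (b == a) && (j == i) then x else s b j.

Fixpoint eval (look : nat -> nat -> nat) (s : store) (e : expr) : nat :=
  match e with
  | EConst k => k
  | EGet a i => s a (eval look s i)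
  | EAdd e1 e2 => eval look s e1 + eval look s e2
  | ESub e1 e2 => eval look s e1 - eval look s e2
  | ELookup e1 e2 => look (eval look s e1) (eval look s e2)
  end.

Fixpoint ecost (e : expr) : nat :=
  match e with
  | EConst _ => 1
  | EGet _ i => (ecost i).+1
  | EAdd e1 e2 | ESub e1 e2 | ELookup e1 e2 => (ecost e1 + ecost e2).+1
  end.

(* [exec look c s k s']: started in [s], the command [c] terminates in [s']
   after [k] elementary operations. *)
Inductive exec (look : nat -> nat -> nat) :
    cmd -> store -> nat -> store -> Prop :=
| exec_skip s : exec look CSkip s 1 s
| exec_set a i e s :
    exec look (CSet a i e) s (ecost i + ecost e).+1
      (update s a (eval look s i) (eval look s e))
| exec_seq c1 c2 s k1 s1 k2 s2 :
    exec look c1 s k1 s1 -> exec look c2 s1 k2 s2 ->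
    exec look (CSeq c1 c2) s (k1 + k2) s2
| exec_if e c1 c2 s k s' :
    exec look (if eval look s e != 0 then c1 else c2) s k s' ->
    exec look (CIf e c1 c2) s (ecost e + k).+1 s'
| exec_while_stop e c s :
    eval look s e = 0 ->
    exec look (CWhile e c) s (ecost e).+1 s
| exec_while_step e c s k1 s1 k2 s2 :
    eval look s e != 0 ->
    exec look c s k1 s1 -> exec look (CWhile e c) s1 k2 s2 ->
    exec look (CWhile e c) s (ecost e + k1 + k2).+1 s2.

Definition first_appearance (V : finType) (G : temporal_graph V) (e : {set V})
    (t : nat) : Prop :=
  e \in layer G t /\ forall s, e \in layer G s -> t <= s.

(* A program sees the vertices through their numbers 0, ..., #|V|.-1.  A pair
   that is never an edge is answered by 0, which is not a time step; nothing is
   assumed about the answers for numbers of no vertex. *)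
Definition lookup_table (V : finType) (G : temporal_graph V)
    (look : nat -> nat -> nat) : Prop :=
  forall u v : V,
    if underlying G u v
    then first_appearance G [set u; v] (look (enum_rank u) (enum_rank v))
    else look (enum_rank u) (enum_rank v) = 0.

(* The input n is in array 0; all other cells are 0. *)
Definition init_store (n : nat) : store := update (fun _ _ => 0) 0 0 n.

(* The output vertices are read off from arrays 1 and 2. *)
Definition outputs (V : finType) (s : store) (p1 p2 : V) : Prop :=
  s 1 0 = enum_rank p1 /\ s 2 0 = enum_rank p2.

(* Main.v *)
(* For an edge [xy] let [H x y] be the component of [y] once [xy] is removed, and
   let [w (x, y)] be the payoff of [y] against [x].  Against [p] no vertex wins more
   than [w (x, y)] for some edge with [p] outside [H x y], and the head [y] of such
   an edge wins at least that much; so the value [B p] of a best response to [p] is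
   the maximum of [w] over the edges that point away from [p].

   Let [mu] be the maximum of [min (w d) (w f)] over edges [d], [f] with disjoint
   components.  Edges with [w > mu] have pairwise intersecting components, and the
   vertices with [B <= mu], which exist, lie in all of these.  If every edge with
   [w = mu] that points away from such a vertex has a head with [B <= mu], then the
   heads of [d] and [f] are an equilibrium.  Otherwise let [x y] be such an edge with
   [B y > mu] and [H x y] largest, let [s] be a best response to [y], and let [q]
   with [B q <= mu] lie behind [s].  Maximality of [H x y] makes [xy] appear only
   after [q] has reached [x]; hence [q] does at least as well against [y] as [s],
   and [y] is a best response to [q].

   Only the [2 (n - 1)] values of [w] are computed in linear time each; whether a
   pair is of one of the two kinds above can be tested in constant time. *)
Require Import Defs.
From mathcomp Require Import all_boot.
From mathcomp Require Import boolp zify.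

Set Implicit Arguments.
Unset Strict Implicit.
Unset Printing Implicit Defensive.

(** * Components of a tree minus an edge *)

Section Halves.
Variables (V : finType) (e : rel V).

Definition cut (x y : V) : rel V :=
  fun u w => e u w && ([set u; w] != [set x; y]).

Definition halftree (x y : V) : {set V} := [set v | connect (cut x y) y v].

(** On a tree this says that [z] is on the path from [u] to [v]. The convexity form spares the
    handling of paths; [betweenP] gives the metric form. *)
Definition between (u z v : V) : Prop :=
  forall x y, e x y -> u \in halftree x y -> v \in halftree x y -> z \in halftree x y.

Lemma between_sym u z v : between u z v -> between v z u.
Proof. by move=> b x y exy hv hu; apply: b exy hu hv. Qed.

Lemma head_halftree x y : y \in halftree x y.
Proof. by rewrite inE connect0. Qed.

Hypotheses (eC : symmetric e) (eirr : irreflexive e) (etree : is_tree e).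

Lemma cut_connect_sym x y : connect_sym (cut x y).
Proof. by apply: sym_connect_sym => u w; rewrite /cut eC setUC. Qed.

(** A simple path from [y] to [x] that avoids the edge would close up to a cycle through it. *)
Lemma tail_halftree x y : e x y -> x \notin halftree x y.
Proof.
move=> exy; have [_ _ acyc] := etree; apply/negP; rewrite inE => /connectP[p].
case/shortenP=> p' pp' up' _ lp'.
have cyc : ucycle e (y :: p').
  rewrite /ucycle up' andbT /cycle rcons_path -lp' exy andbT.
  by apply: sub_path pp' => u w /andP[].
move: (acyc _ cyc) pp' lp' => {cyc up' acyc}.
case: p' => [|z [|w p']] //=.
  by move=> _ _ E; move: exy; rewrite E eirr.
by move=> _ /andP[/andP[_ /negP ne] _] E; case: ne; rewrite E setUC.
Qed.

Lemma halftreeC x y : e x y -> halftree y x = ~: halftree x y.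
Proof.
move=> exy; have [_ conn _] := etree.
have cutC : cut y x =2 cut x y by move=> u w; rewrite /cut /= [[set y; x]]setUC.
apply/setP=> v; rewrite !inE (eq_connect cutC).
have tot : connect (cut x y) x v || connect (cut x y) y v.
  have cl : closed e [pred u | connect (cut x y) x u || connect (cut x y) y u].
    apply: intro_closed; first exact: sym_connect_sym.
    move=> u w euw; rewrite !inE => uA.
    have [Eq|ne] := eqVneq [set u; w] [set x; y].
      have: w \in [set x; y] by rewrite -Eq set22.
      by rewrite !inE => /orP[] /eqP->; rewrite connect0 ?orbT.
    have uw : connect (cut x y) u w by apply: connect1; rewrite /cut /= euw ne.
    by case/orP: uA => uA; rewrite (connect_trans uA uw) ?orbT.
  by have := closed_connect cl (conn x v); rewrite !inE connect0 /= => <-.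
apply/idP/idP => [xv|nyv]; last by case/orP: tot nyv => // ->.
apply/negP => yv; have := tail_halftree exy; rewrite inE.
by rewrite (connect_trans yv) // cut_connect_sym.
Qed.

(** Any edge other than [xy] survives the cut and has both ends in the same component. *)
Lemma halftree_cross x y u w :
  e x y -> e u w -> u \notin halftree x y -> w \in halftree x y -> u = x /\ w = y.
Proof.
move=> exy euw nu hw.
have [Eq|ne] := eqVneq [set u; w] [set x; y]; last first.
  case/negP: nu; move: hw; rewrite !inE => hw; apply: connect_trans hw _.
  by apply: connect1; rewrite /cut /= eC euw setUC.
have: u \in [set x; y] by rewrite -Eq set21.
have: w \in [set x; y] by rewrite -Eq set22.
rewrite !inE => /orP[] /eqP Ew /orP[] /eqP Eu; subst=> //.
- by rewrite eirr in euw.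
- by rewrite head_halftree in nu.
- by rewrite eirr in euw.
Qed.

(** Walking from [z] inside the first component, one could leave the second one only through its
    head [s], which the walk never visits. *)
Lemma halftree_sub x y r s z : e x y -> e r s -> s \notin halftree x y ->
  z \in halftree x y -> z \in halftree r s -> halftree x y \subset halftree r s.
Proof.
move=> exy ers ns zxy zrs; apply/subsetP=> v vxy.
have zv : connect (cut x y) z v.
  by move: zxy vxy; rewrite !inE => yz; apply: connect_trans; rewrite cut_connect_sym.
have cl : closed (cut x y) [predI halftree x y & halftree r s].
  apply: intro_closed; first exact: cut_connect_sym.
  move=> u w cuw; rewrite !inE => /andP[yu us].
  rewrite (connect_trans yu (connect1 cuw)) /=.
  case: (boolP (w \in halftree r s)) => [|nw]; first by rewrite inE.
  have ewu : e w u by rewrite eC; case/andP: cuw.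
  have uH : u \in halftree r s by rewrite inE.
  have [_ E] := halftree_cross ers ewu nw uH.
  by case/negP: ns; rewrite -E inE.
have := closed_connect cl zv; rewrite !inE.
by move: zxy zrs; rewrite !inE => -> -> /esym/andP[].
Qed.

(** [x] is the last vertex but one of a simple path from [z]; the part up to [x] avoids [v] and so
    survives the cut. *)
Lemma prev_vertex z v : z != v -> exists x, e x v /\ z \notin halftree x v.
Proof.
move=> ne; have [_ conn _] := etree.
have /connectP[p] := conn z v; case/shortenP=> p' + + _ lp'.
elim/last_ind: p' lp' => [|p' w _]; first by move=> /= E; rewrite E eqxx in ne.
rewrite last_rcons => <-{w}; rewrite rcons_path => /andP[pp elv] up.
have [x Ex] : {x | x = last z p'} by exists (last z p').
rewrite -Ex in elv; exists x; split=> //.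
have vnotin : v \notin z :: p' by move: up; rewrite -rcons_cons rcons_uniq => /andP[].
have : z \in halftree v x.
  rewrite inE cut_connect_sym; apply/connectP; exists p' => //.
  elim: p' (z) {up Ex} pp vnotin => //= a p' IH b /andP[eba pp].
  rewrite !inE !negb_or => /and3P[nb na np].
  rewrite /cut eba IH ?inE ?negb_or ?na //= andbT.
  apply/eqP => /setP/(_ v); rewrite !inE eqxx.
  by rewrite (negPf nb) (negPf na).
by rewrite halftreeC // inE.
Qed.

Lemma prev_vertex_unique r x x' y : e x y -> e x' y ->
  r \notin halftree x y -> r \notin halftree x' y -> x = x'.
Proof.
move=> exy ex'y nr nr'; apply/eqP; apply/negPn/negP => ne.
have x'H : x' \in halftree x y.
  apply/negPn/negP => nx'; have [E _] := halftree_cross exy ex'y nx' (head_halftree _ _).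
  by rewrite E eqxx in ne.
have eyx' : e y x' by rewrite eC.
case/negP: nr; apply: (subsetP (halftree_sub eyx' exy _ (head_halftree y x') x'H)).
  exact: tail_halftree.
by rewrite halftreeC // inE.
Qed.

Lemma halftree_between_tail x y u v :
  e x y -> u \notin halftree x y -> v \in halftree x y -> between u x v.
Proof.
move=> exy nu hv a b eab ua va; apply/negPn/negP => nx.
have eyx : e y x by rewrite eC.
have := halftree_sub eab exy; rewrite -[halftree x y]setCK -(halftreeC exy).
(* If [halftree a b] contains [y], then [xy] enters it and so is [ab]; otherwise it lies inside
   [halftree x y], which misses [u]. *)
case: (boolP (y \in halftree a b)) => ny.
  have [Ea Eb] := halftree_cross eab exy nx ny.
  by subst; rewrite ua in nu.
move/(_ v isT va); rewrite halftreeC // setCK => /(_ hv)/subsetP/(_ _ ua).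
by rewrite (negPf nu).
Qed.

Lemma halftree_between_head x y u v :
  e x y -> u \notin halftree x y -> v \in halftree x y -> between u y v.
Proof.
move=> exy nu hv; apply: between_sym; apply: (@halftree_between_tail y x).
- by rewrite eC.
- by rewrite halftreeC // inE hv.
- by rewrite halftreeC // inE.
Qed.

Lemma between_prev u z v x :
  between u z v -> e x v -> z \notin halftree x v -> between u z x.
Proof.
move=> b exv nz a c eac ua xa; have evx : e v x by rewrite eC.
case: (boolP (v \in halftree a c)) => hv; first exact: b.
have [<- <-] := halftree_cross eac evx hv xa.
by rewrite halftreeC // inE.
Qed.

Lemma between_notin_halftree u z v x :
  between u z v -> e x v -> z \notin halftree x v -> u \notin halftree x v.
Proof. by move=> b exv; apply: contra => hu; apply: b => //; exact: head_halftree. Qed.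

(** In the search, [X] is the set of visited vertices and [w] a new one: paths within [X] avoid [w]
    and thus the edge [uw]. *)
Lemma connect_restrict_halftree (X : {set V}) u v w : u \in X -> w \notin X -> e u w ->
  connect [rel a b | [&& e a b, a \in X & b \in X]] u v -> v \notin halftree u w.
Proof.
move=> uX wX euw uv; have ewu : e w u by rewrite eC.
suff: v \in halftree w u by rewrite halftreeC // inE.
rewrite inE; apply: connect_sub uv => a b /and3P[eab aX bX].
apply: connect1; rewrite /cut /= eab /=; apply/eqP => /setP/(_ w).
rewrite !inE eqxx /= => /orP[] /eqP E.
  by rewrite E aX in wX.
by rewrite E bX in wX.
Qed.

End Halves.

(** * Arrival times *)

Section Arrival.
Variable (V : finType).
Implicit Types (T : temporal_graph V) (u v x y z : V).

Lemma underlying_sym T : symmetric (underlying T).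
Proof.
by move=> u v; rewrite /underlying; apply/asboolP/asboolP => -[t H]; exists t;
  rewrite setUC.
Qed.

Lemma underlying_irr T : irreflexive (underlying T).
Proof.
move=> u; apply/asboolP => -[t /layer_pairs].
by rewrite setUid cards1.
Qed.

(** The default 0 agrees with the answer of a lookup table for a pair that is never an edge. *)
Definition first_time T u v : nat :=
  if pselect (exists t, [set u; v] \in layer T t) is left h then ex_minn h else 0.

Lemma first_timeC T u v : first_time T u v = first_time T v u.
Proof. by rewrite /first_time [[set u; v]]setUC. Qed.

Lemma first_timeP T u v :
  underlying T u v -> first_appearance T [set u; v] (first_time T u v).
Proof.
move=> /asboolP uv; rewrite /first_time; case: pselect => // h.
by case: ex_minnP => t ht hmin; split.
Qed.

Lemma first_time_unique T u v t : first_appearance T [set u; v] t ->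
  t = first_time T u v.
Proof.
move=> [ht hmin]; have uv : underlying T u v by apply/asboolP; exists t.
have [ht' hmin'] := first_timeP uv.
by apply/eqP; rewrite eqn_leq hmin // hmin'.
Qed.

Lemma first_time_gt0 T u v : underlying T u v -> 0 < first_time T u v.
Proof.
move=> /first_timeP[]; case: (first_time T u v) => //.
by rewrite layer0 inE.
Qed.

Lemma mem_layer T u v t : monotonically_growing T ->
  ([set u; v] \in layer T t) = underlying T u v && (first_time T u v <= t).
Proof.
move=> mono; apply/idP/andP => [h|[uv]].
  have uv : underlying T u v by apply/asboolP; exists t.
  by split=> //; have [_] := first_timeP uv; apply.
have pos := first_time_gt0 uv; have [h _] := first_timeP uv.
elim: t => [|t IH]; first by rewrite leqNgt pos.
rewrite leq_eqVlt => /predU1P[<- //|lt]; apply: (subsetP (mono _ _)); last exact: IH.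
exact: leq_trans pos lt.
Qed.

Lemma arrives_refl T u : arrives T u u 0.
Proof. by apply/asboolP; exists [::]. Qed.

Lemma arrives_edge T u x y t t' : monotonically_growing T -> arrives T u x t ->
  underlying T x y -> t < t' -> first_time T x y <= t' -> arrives T u y t'.
Proof.
move=> mono /asboolP[w [ww lw]] exy lt le; apply/asboolP.
exists (rcons w (y, t')); rewrite last_rcons; split=> //.
by rewrite /temporal_walk rcons_path -/(temporal_walk T u w) ww lw /= lt mem_layer // exy.
Qed.

(** On a growing tree every vertex is reached eventually ([arrives_ex]), so the default never occurs
    there. *)
Definition dt T u v : nat := odflt 0 (td T u v).

Variable T : temporal_graph V.
Hypotheses (tree : temporal_tree T) (mono : monotonically_growing T).
Let e := underlying T.
Let eC : symmetric e := underlying_sym T.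
Let eirr : irreflexive e := underlying_irr T.

Lemma arrives_ex u v : exists t, arrives T u v t.
Proof.
have [_ conn _] := tree; have /connectP[p + ->] := conn u v.
elim/last_ind: p => [|p y IH] /=; first by exists 0; apply: arrives_refl.
rewrite rcons_path last_rcons => /andP[/IH[t ht] ey].
exists (maxn t.+1 (first_time T (last u p) y)); apply: arrives_edge ht ey _ _ => //; lia.
Qed.

Lemma tdE u v : td T u v = Some (dt T u v).
Proof. by rewrite /dt /td; case: pselect => // -[]; exact: arrives_ex. Qed.

Lemma dt_arrives u v : arrives T u v (dt T u v).
Proof.
rewrite /dt /td; case: pselect => [h|[]]; last exact: arrives_ex.
by case: ex_minnP.
Qed.

Lemma dt_min u v t : arrives T u v t -> dt T u v <= t.
Proof.
move=> ht; rewrite /dt /td; case: pselect => // h.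
by case: ex_minnP => m _; apply.
Qed.

Lemma dtxx u : dt T u u = 0.
Proof. by apply/eqP; rewrite -leqn0; apply/dt_min/arrives_refl. Qed.

Lemma dt_edge u x y : e x y -> dt T u y <= maxn (dt T u x).+1 (first_time T x y).
Proof. by move=> exy; apply: dt_min; apply: arrives_edge (dt_arrives u x) exy _ _ => //; lia. Qed.

(** A walk into the component has to cross [xy], neither before the edge appears nor before it can
    be at [x]. *)
Lemma dt_step u x y : e x y -> u \notin halftree e x y ->
  dt T u y = maxn (dt T u x).+1 (first_time T x y).
Proof.
move=> exy nu; apply/eqP; rewrite eqn_leq dt_edge //=.
suff crossing t v : v \in halftree e x y -> arrives T u v t ->
    maxn (dt T u x).+1 (first_time T x y) <= t.
  exact: crossing (head_halftree _ _ _) (dt_arrives _ _).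
(* Induction on the arrival time: the last step of the walk either stays inside the component or is
   the crossing itself. *)
elim/ltn_ind: t v => t IH v hv /asboolP[w []].
case/lastP: w => [_ [E _]|w [v2 t2]]; first by rewrite -E (negPf nu) in hv.
rewrite last_rcons /temporal_walk rcons_path -/(temporal_walk T u w) /= mem_layer //.
move=> /andP[ww]; case El: (last (u, 0) w) => [v' t'] /= /and3P[lt ev'v le] [Ev Et]; subst v2 t2.
have hv' : arrives T u v' t' by apply/asboolP; exists w.
case: (boolP (v' \in halftree e x y)) => hh.
  by apply: leq_trans (IH _ lt _ hh hv') _; apply: ltnW.
have [Ex Ey] := halftree_cross eC eirr exy ev'v hh hv; subst v' v.
by have := dt_min hv'; lia.
Qed.

End Arrival.

(** * Hop distance as temporal distance in a static graph *)

Section Static.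
Variables (V : finType) (T : temporal_graph V).

(** With every edge present from time 1 on, temporal distance is hop distance, so the results on
    arrival times apply to the latter. *)
Definition static_layer (t : nat) : {set {set V}} :=
  if t is 0 then set0 else [set f | `[< exists s, f \in layer T s >]].

Lemma static_layer_pairs t f : f \in static_layer t -> #|f| = 2.
Proof.
case: t => [|t]; first by rewrite inE.
by rewrite inE => /asboolP[s]; apply: layer_pairs.
Qed.

Lemma static_lifetime :
  exists tau, 0 < tau /\ forall t, tau <= t -> static_layer t = static_layer tau.
Proof. by exists 1; split=> // -[]. Qed.

Definition static : temporal_graph V :=
  TemporalGraph static_layer_pairs (erefl : static_layer 0 = set0) static_lifetime.

Lemma underlying_static : underlying static = underlying T.
Proof.
apply/funext => u; apply/funext => v; apply/asboolP/asboolP => -[t].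
  by case: t => [|t]; rewrite inE // => /asboolP.
by move=> h; exists 1; rewrite inE; apply/asboolP; exists t.
Qed.

Lemma static_mono : monotonically_growing static.
Proof. by case. Qed.

Lemma first_time_static u v : underlying T u v -> first_time static u v = 1.
Proof.
move=> uv; apply/esym/first_time_unique; split.
  by rewrite inE.
by case=> //; rewrite inE.
Qed.

End Static.

(** * Temporal and hop distances along paths *)

Section Distances.
Variables (V : finType) (T : temporal_graph V).
Hypotheses (tree : temporal_tree T) (mono : monotonically_growing T).
Local Notation e := (underlying T).
Local Notation H := (halftree e).
Local Notation a := (first_time T).
Implicit Types p q u v x y z : V.

Let eC : symmetric e := underlying_sym T.
Let eirr : irreflexive e := underlying_irr T.
Let prevP := prev_vertex eC eirr tree.

Definition dist u v : nat := dt (static T) u v.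

Let static_tree : temporal_tree (static T).
Proof. by rewrite /temporal_tree underlying_static. Qed.

Lemma distxx u : dist u u = 0.
Proof. exact: dtxx. Qed.

Lemma dist_step u x y : e x y -> u \notin H x y -> dist u y = (dist u x).+1.
Proof.
move=> exy nu; rewrite /dist (@dt_step _ _ static_tree (@static_mono _ _) u x y).
- by rewrite first_time_static // maxnSS maxn0.
- by rewrite underlying_static.
- by rewrite underlying_static.
Qed.

(** Beyond [z], a traveller from [u] either never waits, which gives the first term, or waits for
    some edge; after the last wait it moves together with a traveller that started at [z]. *)
Lemma dt_between u z v : between e u z v ->
  dt T u v = maxn (dt T u z + dist z v) (dt T z v).
Proof.
have [n] := ubnP (dist z v); elim: n v => // n IH v le b.
have [<-|ne] := eqVneq z v; first by rewrite distxx dtxx addn0 maxn0.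
have [x [exv nz]] := prevP ne.
have nu := between_notin_halftree b exv nz.
have bx := between_prev eC eirr tree b exv nz.
have dz := dist_step exv nz.
rewrite (dt_step tree mono exv nu) (dt_step tree mono exv nz) IH ?dz //; lia.
Qed.

Lemma dt_triangle u z v : dt T u v <= maxn (dt T u z + dist z v) (dt T z v).
Proof.
have [n] := ubnP (dist z v); elim: n v => // n IH v le.
have [<-|ne] := eqVneq z v; first by rewrite distxx dtxx addn0 maxn0.
have [x [exv nz]] := prevP ne.
have dz := dist_step exv nz.
have := dt_edge tree mono u exv; rewrite (dt_step tree mono exv nz) dz.
have := IH x; lia.
Qed.

Lemma dist_gt0 u v : u != v -> 0 < dist u v.
Proof. by move=> ne; have [x [exv nu]] := prevP ne; rewrite (dist_step exv nu). Qed.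

Lemma dt_nbr x y : e x y -> dt T x y = a x y.
Proof.
move=> exy; rewrite (dt_step tree mono exy) ?dtxx ?(tail_halftree _ tree) //.
have := first_time_gt0 exy; lia.
Qed.

End Distances.

(** * Betweenness in terms of hop distance, and medians *)

Section DistanceSymmetry.
Variables (V : finType) (T : temporal_graph V).
Hypotheses (tree : temporal_tree T) (mono : monotonically_growing T).
Local Notation e := (underlying T).
Local Notation H := (halftree e).
Local Notation dist := (dist T).
Implicit Types p q u v x y z : V.

Let eC : symmetric e := underlying_sym T.
Let eirr : irreflexive e := underlying_irr T.
Let HC := halftreeC eC eirr tree.
Let prevP := prev_vertex eC eirr tree.
Let betw_tail := halftree_between_tail eC eirr tree.
Let betw_head := halftree_between_head eC eirr tree.

Let static_tree : temporal_tree (static T).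
Proof. by rewrite /temporal_tree underlying_static. Qed.


Lemma dist_triangle u z v : dist u v <= dist u z + dist z v.
Proof.
have [n] := ubnP (dist z v); elim: n v => // n IH v le.
have [<-|ne] := eqVneq z v; first by rewrite distxx // addn0.
have [x [exv nz]] := prevP ne.
have dz := dist_step tree exv nz.
have := @dt_edge _ _ static_tree (@static_mono _ _) u x v.
rewrite underlying_static first_time_static // => /(_ exv).
have := IH x; rewrite -/(dist u v) -/(dist u x); lia.
Qed.

Lemma dist_between u z v : between e u z v -> dist u v = dist u z + dist z v.
Proof.
have [n] := ubnP (dist z v); elim: n v => // n IH v le b.
have [<-|ne] := eqVneq z v; first by rewrite distxx // addn0.
have [x [exv nz]] := prevP ne.
have nu := between_notin_halftree b exv nz.
have bx := between_prev eC eirr tree b exv nz.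
have dz := dist_step tree exv nz.
rewrite (dist_step tree exv nu) dz IH //; lia.
Qed.

Lemma dist_edge x y : e x y -> dist x y = 1.
Proof. by move=> exy; rewrite (dist_step tree exy) ?distxx ?(tail_halftree eirr tree). Qed.

Lemma dist_sym u v : dist u v = dist v u.
Proof.
have [n] := ubnP (dist u v); elim: n v => // n IH v le.
have [<- //|ne] := eqVneq u v.
have [x [exv nu]] := prevP ne; have evx : e v x by rewrite eC.
have dz := dist_step tree exv nu.
rewrite dz (@dist_between v x u); first by rewrite (dist_edge evx) -IH; lia.
by apply: between_sym; apply: betw_tail exv nu (head_halftree _ _ _).
Qed.

Lemma mem_halftreeE v x y : e x y -> (v \in H x y) = (dist v y < dist v x).
Proof.
move=> exy; have eyx : e y x by rewrite eC.
case: (boolP (v \in H x y)) => hv.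
  have nv : v \notin H y x by rewrite (HC exy) inE hv.
  by rewrite (dist_step tree eyx nv) ltnSn.
by rewrite (dist_step tree exy hv); lia.
Qed.

Lemma betweenP u z v : reflect (between e u z v) (dist u z + dist z v <= dist u v).
Proof.
apply: (iffP idP) => [le x y exy ux vx|/dist_between-> //].
apply/negPn/negP => nz.
(* Both [u] and [v] reach [z] through [y], so a detour to [z] covers the way between [y] and [z]
   twice. *)
have buz := between_sym (betw_head exy nz ux).
have bzv := betw_head exy nz vx.
have zy : z != y by apply: contraNneq nz => ->; exact: head_halftree.
move: le; rewrite (dist_between buz) (dist_between bzv).
have := dist_triangle u y v; have := dist_gt0 tree zy; lia.
Qed.

(** [z] is the vertex of the path from [p] to [q] that is closest to [v]. *)
Lemma median_ex p q v :
  exists z, [/\ between e p z q, between e p z v & between e q z v].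
Proof.
have bpp : `[< between e p p q >] by apply/asboolP.
case: (@arg_minnP _ p (fun z => `[< between e p z q >]) (fun z => dist z v) bpp).
move=> z /asboolP bz zmin.
(* A component with [r] and [v] but without [z] would have its head on the path from [p] to [q] and
   closer to [v]. *)
have shift r s x y : between e r z s -> (forall b, between e r b s -> between e p b q) ->
    e x y -> r \in H x y -> v \in H x y -> z \in H x y.
  move=> brzs imp exy rx vx; apply/negPn/negP => nz.
  have ns : s \notin H x y by apply: contra nz; exact: brzs.
  have byz := betw_head exy nz vx.
  have zy : z != y by apply: contraNneq nz => ->; exact: head_halftree.
  have byq : `[< between e p y q >].
    by apply/asboolP/imp/between_sym; exact: betw_head exy ns rx.
  have := zmin _ byq; rewrite (dist_between byz); have := dist_gt0 tree zy; lia.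
exists z; split=> // x y exy.
  exact: (shift p q x y bz (fun _ => id) exy).
exact: (shift q p x y (between_sym bz) (fun b => @between_sym _ _ _ _ _) exy).
Qed.

End DistanceSymmetry.

(** * Payoffs against neighbours *)

Section Payoffs.
Variables (V : finType) (T : temporal_graph V).
Hypotheses (tree : temporal_tree T) (mono : monotonically_growing T).
Local Notation e := (underlying T).
Local Notation H := (halftree e).
Local Notation a := (first_time T).
Local Notation dist := (dist T).
Local Notation dt := (dt T).
Implicit Types p q s u v x y z : V.

Let eC : symmetric e := underlying_sym T.
Let eirr : irreflexive e := underlying_irr T.
Let HC := halftreeC eC eirr tree.
Let prevP := prev_vertex eC eirr tree.
Let betw_tail := halftree_between_tail eC eirr tree.
Let betw_head := halftree_between_head eC eirr tree.
Let tailN := tail_halftree eirr tree.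

Definition wins p q : {set V} := [set v | dt p v < dt q v].

Lemma payoffE p q : payoff T p q = #|wins p q|.
Proof. by rewrite /payoff; apply: eq_card => v; rewrite !inE !(tdE tree mono). Qed.

Lemma payoffxx p : payoff T p p = 0.
Proof. by rewrite payoffE; apply: eq_card0 => v; rewrite inE ltnn. Qed.

Lemma dt_le_between u z v : between e u z v -> dt z v <= dt u v.
Proof. by move=> /(dt_between tree mono)->; lia. Qed.

Lemma wins_head x y v : e x y -> v \in wins y x -> v \in H x y.
Proof.
move=> exy; rewrite inE => lt; apply/negPn/negP => nv.
have eyx : e y x by rewrite eC.
have := dt_le_between (betw_head eyx (tailN eyx) (_ : v \in H y x)).
by rewrite HC // in_setC nv => /(_ isT); lia.
Qed.

(** [y] beats [x] only inside [H x y], and [x] lies on the way of [p] into that component. *)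
Lemma edge_payoff_le p x y : e x y -> p \notin H x y -> payoff T y x <= payoff T y p.
Proof.
move=> exy np; rewrite !payoffE; apply: subset_leq_card; apply/subsetP => v vw.
have hv := wins_head exy vw; move: vw; rewrite !inE => /leq_trans; apply.
exact: dt_le_between (betw_tail exy np hv).
Qed.

(* Walking from [q] towards [p] never lowers the payoff until the edge to be
   crossed appears too late for [p] to reach [q] without waiting for it; from
   there on, [p] and the tail of that edge are equally strong beyond it. *)
Lemma payoff_le_edge p q : q != p ->
  exists x y, [/\ e x y, p \notin H x y & payoff T q p <= payoff T y x].
Proof.
have [n] := ubnP (dist p q); elim: n q => // n IH q le ne.
have [|x [exq np]] := prevP (_ : p != q); first by rewrite eq_sym.
have dpq := dt_step tree mono exq np.
have [late|early] := leqP (dt p x).+1 (a x q).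
  exists x, q; split=> //; rewrite !payoffE; apply: subset_leq_card.
  apply/subsetP => v; rewrite !inE => lt.
  case: (boolP (v \in H x q)) => hv.
    have := dt_between tree mono (betw_head exq np hv).
    have := dt_between tree mono (betw_head exq (tailN exq) hv).
    rewrite (dt_nbr tree mono exq); lia.
  (* On this side [q] wins nothing, since [p] is at [x] before the edge lets [q] through. *)
  have eqx : e q x by rewrite eC.
  have := dt_between tree mono (betw_head eqx (tailN eqx) (_ : v \in H q x)).
  rewrite HC // in_setC hv (dt_nbr tree mono eqx) first_timeC => /(_ isT).
  have := dt_triangle tree mono p x v; lia.
have xp : x != p.
  by apply/eqP => E; move: early (first_time_gt0 exq); rewrite E dtxx; lia.
have [|y [z [eyz ny le']]] := IH x _ xp.
  by move: le; rewrite (dist_step tree exq np).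
(* Moving from [q] to [x] keeps every win: [x] reaches [q] earlier than [p] does, and on the other
   side [x] is on the way of [q]. *)
exists y, z; split=> //; apply: leq_trans le'; rewrite !payoffE.
apply: subset_leq_card; apply/subsetP => v; rewrite !inE => lt.
case: (boolP (v \in H x q)) => hv.
  have := dt_between tree mono (betw_head exq np hv).
  have := dt_between tree mono (betw_head exq (tailN exq) hv).
  rewrite (dt_nbr tree mono exq); lia.
have eqx : e q x by rewrite eC.
have hv' : v \in H q x by rewrite HC // in_setC.
by apply: leq_ltn_trans lt; apply: dt_le_between; apply: betw_head eqx (tailN eqx) hv'.
Qed.

(* [y] leaves the edge [x y] only after [q] has reached [x], so from there on
   [q] is ahead of [y] everywhere, and being farther away costs [q] nothing. *)
Lemma payoff_behind_late_edge x y q s : e x y -> q \notin H x y -> dt q x < a x y ->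
  between e q s y -> payoff T s y <= payoff T q y.
Proof.
move=> exy nq late bs; rewrite !payoffE; apply: subset_leq_card.
apply/subsetP => v; rewrite !inE => lt.
have eyx : e y x by rewrite eC.
(* [z] is where the way to [v] leaves the path from [q] to [y]; the way from [s] to [v] passes it as
   well. *)
have [z [bqzy bqzv byzv]] := median_ex tree q y v.
have bszv : between e s z v.
  move=> b c ebc sb vb; apply/negPn/negP => nz.
  have nqb : q \notin H b c by apply: contra nz => qb; apply: bqzv.
  have nyb : y \notin H b c by apply: contra nz => yb; apply: byzv.
  have ecb : e c b by rewrite eC.
  by have := bs _ _ ecb; rewrite (HC ebc) !in_setC nqb nyb sb => /(_ isT isT).
have zv := leq_ltn_trans (dt_le_between bszv) lt.
have zy : z != y by apply: contraTneq zv => ->; rewrite ltnn.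
(* The only vertex of the path beyond the edge is [y], whereas [z] beats [y] at [v]. *)
have nz : z \notin H x y.
  apply/negP => hz; have := dist_between tree (betw_head exy nq hz).
  by have := dist_between tree bqzy; have := dist_gt0 tree zy; lia.
(* [q] is at [z] before the edge appears and [y] is not, so [q] inherits from [z] the win at [v]. *)
have late_y : a x y <= dt y z.
  have hz : z \in H y x by rewrite HC // in_setC.
  rewrite (dt_between tree mono (betw_head eyx (tailN eyx) hz)).
  by rewrite (dt_nbr tree mono eyx) first_timeC; lia.
have early_q : dt q z <= dt q x.
  by rewrite (dt_between tree mono (between_prev eC eirr tree bqzy exy nz)); lia.
move: (zv); rewrite (dt_between tree mono bqzv) (dt_between tree mono byzv); lia.
Qed.

(** [c] is at [x] in time and crosses together with [x], while [b] crosses at least one step later.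
    Where [y] beats [x], the latter never waits beyond [y], so [b] cannot make up for its delay. *)
Lemma payoff_over_late_edge b c x y : e b c -> e x y ->
  b \notin H x y -> c \notin H x y -> x \in H b c ->
  dt c x < a x y <= dt b x -> payoff T y x <= payoff T c b.
Proof.
move=> ebc exy nb nc hx /andP[late slow]; rewrite !payoffE; apply: subset_leq_card.
apply/subsetP => v vw; have hv := wins_head exy vw; move: vw; rewrite !inE.
have := dt_between tree mono (betw_head exy nb hv).
have := dt_between tree mono (betw_head exy nc hv).
have := dt_between tree mono (betw_head exy (tailN exy) hv).
rewrite (dt_nbr tree mono exy) !(dt_step tree mono exy) //; lia.
Qed.

(** Induction along the way from [c] to [x]: if the next vertex [c'] is in time but [c] is not, then
    by [payoff_over_late_edge] the edge from [c] to [c'] is worth at least as much as [xy]. *)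
Lemma late_edge x y c : e x y -> c \notin H x y ->
  (forall b b', e b b' -> c \notin H b b' -> H x y \proper H b b' ->
     payoff T b' b < payoff T y x) ->
  dt c x < a x y.
Proof.
move=> exy; have [n] := ubnP (dist x c); elim: n c => // n IH c le nc small.
have [->|ne] := eqVneq c x; first by rewrite dtxx first_time_gt0.
have [|c' [ec'c nx]] := prevP (_ : x != c); first by rewrite eq_sym.
have ecc' : e c c' by rewrite eC.
have hx : x \in H c c' by rewrite HC // in_setC.
have nc' : c' \notin H x y.
  apply/negP => hc'; have [E _] := halftree_cross eC eirr exy ecc' nc hc'.
  by rewrite E eqxx in ne.
have eyx : e y x by rewrite eC.
have hy : y \in H c c'.
  apply/negPn/negP => ny; have [E _] := halftree_cross eC eirr ecc' eyx ny hx.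
  by case/negP: nc; rewrite -E head_halftree.
have nest : H x y \proper H c c'.
  apply/properP; split; last by exists x => //; exact: tailN.
  exact: halftree_sub exy ecc' nc' (head_halftree _ _ _) hy.
have late : dt c' x < a x y.
  apply: IH => //; first by move: le; rewrite (dist_step tree ec'c nx).
  move=> b b' ebb' nb nst; apply: small => //.
  (* An edge that points away from [c'] but not from [c] leads from [c'] to [c], and [y] is not
     behind it. *)
  apply/negP => hb; have [Eb Eb'] := halftree_cross eC eirr ebb' ec'c nb hb; subst b b'.
  move: nst => /properP[/subsetP/(_ y (head_halftree _ _ _)) + _].
  by move: hy; rewrite (HC ec'c) !in_setC => /negPf->.
rewrite ltnNge; apply/negP => slow.
have := small _ _ ecc' (tailN ecc') nest.
rewrite ltnNge => /negP; apply.
by apply: (@payoff_over_late_edge c c') => //; rewrite late slow.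
Qed.

End Payoffs.

(** * Constant-time certificates *)

Section Certificates.
Variables (V : finType) (T : temporal_graph V).
Hypotheses (tree : temporal_tree T) (mono : monotonically_growing T).
Local Notation e := (underlying T).
Local Notation H := (halftree e).
Local Notation a := (first_time T).
Local Notation dist := (dist T).
Local Notation dt := (dt T).
Implicit Types c p q s u v x y z : V.

Let eC : symmetric e := underlying_sym T.
Let eirr : irreflexive e := underlying_irr T.
Let HC := halftreeC eC eirr tree.
Let prevP := prev_vertex eC eirr tree.

(* [W v y] and [A v y] are the payoff of [y] against its predecessor on the path
   from [v] and the appearance time of the last edge of that path. *)
Record tables (W A : V -> V -> nat) (B : V -> nat) (S : V -> V) : Prop := Tables {
  tables_edge : forall v x y, e x y -> v \notin H x y ->
    [/\ W v y = payoff T y x, A v y = a x y & payoff T y x <= B v];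
  tables_diag : forall v, W v v = 0;
  tables_best : forall v, B v = 0 \/
    exists r, [/\ e r (S v), v \notin H r (S v) & payoff T (S v) r = B v]
}.

Variables (W A : V -> V -> nat) (B : V -> nat) (S : V -> V).
Hypothesis tab : tables W A B S.

(* Under the second alternative the last edge towards [y] appears after [q] has
   reached it, and the best response [S y] lies on the way. *)
Definition certified q y : bool :=
  (B q <= W q y) &&
  ((B y <= W y q) || (dt q y <= A q y) && (dist y (S y) + dist (S y) q <= dist y q)).

Lemma payoff_le_best p q : payoff T q p <= B p.
Proof.
have [->|ne] := eqVneq q p; first by rewrite payoffxx.
have [x [y [exy np le]]] := payoff_le_edge tree mono ne.
by have [_ _] := tables_edge tab exy np; apply: leq_trans.
Qed.

Lemma tables_le_payoff q y : W q y <= payoff T y q.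
Proof.
have [->|ne] := eqVneq q y; first by rewrite (tables_diag tab).
have [x [exy nq]] := prevP ne.
by have [-> _ _] := tables_edge tab exy nq; apply: edge_payoff_le.
Qed.

Lemma certified_nash q y : certified q y -> nash_equilibrium T q y.
Proof.
case/andP=> wq cert; split=> p; last first.
  by apply: leq_trans (leq_trans _ wq) (tables_le_payoff _ _); apply: payoff_le_best.
apply: leq_trans (payoff_le_best _ _) _.
case/orP: cert => [wy|/andP[late bet]].
  exact: leq_trans wy (tables_le_payoff _ _).
have [-> //|[r [ers ny <-]]] := tables_best tab y.
have bet' : between e q (S y) y.
  by apply: between_sym; apply/betweenP.
(* With [q = y] the distance condition would put [S y] at [y], yet [y] is not behind the edge with
   head [S y]. *)
have qy : q != y.
  apply/eqP => Eq; move: bet; rewrite Eq distxx // leqn0 addn_eq0 => /andP[/eqP d0 _].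
  case/negP: ny; suff E : S y = y by rewrite E head_halftree.
  by apply/esym/eqP/negPn/negP => /(dist_gt0 tree); rewrite d0.
have [x [exy nq]] := prevP qy.
have [_ Aqy _] := tables_edge tab exy nq.
apply: leq_trans (payoff_behind_late_edge tree mono exy nq _ bet').
  exact: edge_payoff_le.
(* [dt q y <= A q y] means that the maximum in [dt_step] is the appearance time, so [q] is at [x]
   strictly before it. *)
by move: late; rewrite Aqy (dt_step tree mono exy nq); lia.
Qed.

Let w (d : V * V) : nat := payoff T d.2 d.1.
Let dir (d : V * V) : bool := e d.1 d.2.
Let HH (d : V * V) : {set V} := H d.1 d.2.

Let best_ge d c : dir d -> c \notin HH d -> w d <= B c.
Proof. by move=> dd nc; have [_ _] := tables_edge tab dd nc. Qed.

Let best_edge c mu : mu < B c -> exists d, [/\ dir d, c \notin HH d & w d = B c] /\ d.2 = S c.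
Proof.
move=> lt; case: (tables_best tab c) => [E|[r [ers nc wE]]]; first by rewrite E in lt.
by exists (r, S c).
Qed.

Let nest d f z : dir d -> dir f -> f.2 \notin HH d -> z \in HH d -> z \in HH f ->
  HH d \subset HH f.
Proof. exact: halftree_sub. Qed.

Lemma certified_ex : exists q y, certified q y.
Proof.
have [v0 _] : exists v0 : V, true.
  by have [/card_gt0P[v0 _] _ _] := tree; exists v0.
(* If nothing can be won against [v0], both players may stay there. *)
have [B0|Bpos] := posnP (B v0).
  by exists v0, v0; rewrite /certified B0.
have [d0 [[dd0 _ _] _]] := best_edge Bpos.
pose opp (df : (V * V) * (V * V)) :=
  [&& dir df.1, dir df.2 & [disjoint HH df.1 & HH df.2]].
have opp0 : opp (d0, (d0.2, d0.1)).
  have d0e : e d0.1 d0.2 := dd0.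
  rewrite /opp /dir /HH /= (HC d0e) [e d0.2 _]eC d0e.
  by rewrite -setI_eq0 setICr eqxx.
case: (arg_maxnP (fun df => minn (w df.1) (w df.2)) opp0) => -[d f] /and3P[/= dd df disj].
set mu := minn (w d) (w f) => mumax.
have {mumax} meet g h : dir g -> dir h -> mu < w g -> mu < w h ->
    exists2 z, z \in HH g & z \in HH h.
  move=> dg dh lg lh; case: (boolP [exists z in HH g, z \in HH h]) => [/exists_inP //|nex].
  have : opp (g, h).
    rewrite /opp /= dg dh; apply/pred0P => z /=; apply/negP => /andP[zg zh].
    by case/negP: nex; apply/exists_inP; exists z.
  by move/mumax => /=; lia.
have heavy g c : dir g -> mu < w g -> B c <= mu -> c \in HH g.
  by move=> dg lg Bc; apply/negPn/negP => nc; have := best_ge dg nc; lia.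
(* Take a smallest component of weight above [mu] inside that of [g]. If [B] exceeded [mu] at its
   head, a best response to the head would have a component that meets the smallest one and misses
   its head, hence a strictly smaller one. *)
have core g : dir g -> mu < w g ->
    exists h, [/\ dir h, mu < w h, HH h \subset HH g & B h.2 <= mu].
  move=> dg lg.
  have Pg : [&& dir g, mu < w g & HH g \subset HH g] by rewrite dg lg subxx.
  case: (@arg_minnP _ g (fun h => [&& dir h, mu < w h & HH h \subset HH g])
           (fun h => #|HH h|) Pg) => h /and3P[dh lh hg] hmin.
  exists h; split=> //; rewrite leqNgt; apply/negP => lt.
  have [h' [[dh' nh' wh'] _]] := best_edge lt.
  rewrite -wh' in lt.
  have [z zh' zh] := meet _ _ dh' dh lt lh.
  have sub := nest dh' dh nh' zh' zh.
  have := hmin h'; rewrite dh' lt (subset_trans sub hg) => /(_ isT).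
  rewrite leqNgt => /negP; apply; apply: proper_card; apply/properP; split=> //.
  by exists h.2 => //; apply: head_halftree.
have [c0 Bc0] : exists c, B c <= mu.
  have [lt|le] := ltnP mu (B v0); last by exists v0.
  have [g [[dg _ wg] _]] := best_edge lt; rewrite -wg in lt.
  by have [h [_ _ _ Bh]] := core _ dg lt; exists h.2.
pose adm g := [&& dir g, w g == mu & [exists c, (B c <= mu) && (c \notin HH g)]].
have [/existsP[g0 adm0]|] := boolP [exists g, adm g && (mu < B g.2)].
  case: (@arg_maxnP _ g0 (fun g => adm g && (mu < B g.2)) (fun g => #|HH g|) adm0) => -[x y].
  rewrite /adm /dir /HH /= => /andP[/and3P[exy /eqP wxy /existsP[c /andP[Bc nc]]] By] gmax.
  have [g [[dg ny wg] gS]] := best_edge By; rewrite -wg in By.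
  have [h [dh lh hg Bh]] := core _ dg By.
  have sg : h.2 \in HH g by apply: (subsetP hg); apply: head_halftree.
  (* Otherwise the component of [g] would lie in [H x y], but by [heavy] it contains [c]. *)
  have ns : h.2 \notin H x y.
    apply/negP => hs; case/negP: nc.
    have := @nest g (x, y) h.2 dg exy ny sg hs => /subsetP; apply.
    exact: heavy.
  exists h.2, y; rewrite /certified.
  have [-> -> _] := tables_edge tab exy ns.
  rewrite -/(w (x, y)) wxy Bh /=; apply/orP; right; apply/andP; split.
    rewrite (dt_step tree mono exy ns) geq_max leqnn andbT.
    (* A larger component of weight [mu] contradicts maximality unless [B b' <= mu]. Then [b'] is in
       the component of [h], which forces [H b b'] into that of [g], where [y] is not. *)
    apply: late_edge exy ns _ => // b b' ebb' nb sub.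
    rewrite -/(w (x, y)) wxy -/(w (b, b')).
    have := @best_ge (b, b') h.2 ebb' nb => /leq_trans/(_ Bh); rewrite leq_eqVlt.
    case/orP=> // /eqP wbb'.
    have : #|H b b'| <= #|H x y|.
      apply: (gmax (b, b')); rewrite /adm /dir /HH /= ebb' wbb' eqxx /=.
      apply/andP; split; first by apply/existsP; exists h.2; rewrite Bh.
      rewrite ltnNge; apply/negP => Bb'.
      have b'h : b' \in HH h by apply: heavy.
      have := @nest (b, b') h b' ebb' dh nb (head_halftree _ _ _) b'h.
      move=> /subsetP/(_ y (subsetP (proper_sub sub) y (head_halftree _ _ _))).
      by move/(subsetP hg); rewrite (negPf ny).
    by rewrite leqNgt proper_card.
  apply/(betweenP tree); rewrite -gS.
  exact: (halftree_between_head eC eirr tree dg ny sg).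
rewrite negb_exists => /forallP light.
have light' g c : dir g -> w g = mu -> B c <= mu -> c \notin HH g -> B g.2 <= mu.
  move=> dg wg Bc nc; have := light g; rewrite negb_and -leqNgt /adm dg wg eqxx /=.
  case/orP=> // /existsP[]; by exists c; rewrite Bc.
(* [c] bounds the weight of [g], so [B <= mu] at the head of [g]; this head is outside the component
   of [h] and bounds the weight of [h] in turn. *)
have pair g h c : dir g -> dir h -> [disjoint HH g & HH h] -> mu <= w g -> mu <= w h ->
    B c <= mu -> c \notin HH g -> certified h.2 g.2.
  move=> dg dh dis lg lh Bc nc.
  have ngh : g.2 \notin HH h by rewrite (disjointFr dis) // head_halftree.
  have nhg : h.2 \notin HH g by rewrite (disjointFl dis) // head_halftree.
  have wg : w g = mu by apply/eqP; rewrite eqn_leq lg (leq_trans (best_ge dg nc) Bc).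
  have Bg := light' g c dg wg Bc nc.
  have wh : w h = mu by apply/eqP; rewrite eqn_leq lh (leq_trans (best_ge dh ngh) Bg).
  have Bh := light' h _ dh wh Bg ngh.
  have [E _ _] := tables_edge tab dg nhg; have [E' _ _] := tables_edge tab dh ngh.
  rewrite /certified E E' -/(w g) -/(w h) wg wh Bg Bh //.
have [ld lf] : mu <= w d /\ mu <= w f by rewrite /mu; lia.
(* [c0] is outside at least one of the two disjoint components. *)
case: (boolP (c0 \in HH d)) => hc.
  exists d.2, f.2; apply: (pair f d c0) => //; first by rewrite disjoint_sym.
  by rewrite (disjointFr disj hc).
by exists f.2, d.2; apply: (pair d f c0).
Qed.

End Certificates.

(** * Costed program logic *)

Fixpoint writes (c : cmd) : seq nat :=
  match c with
  | CSkip => [::]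
  | CSet a _ _ => [:: a]
  | CSeq c1 c2 | CIf _ c1 c2 => writes c1 ++ writes c2
  | CWhile _ c => writes c
  end.

Definition same_outside (A : seq nat) (s t : store) : Prop :=
  forall a i, a \notin A -> t a i = s a i.

Lemma exec_writes look c s k t : exec look c s k t -> same_outside (writes c) s t.
Proof.
elim=> {c s k t} //.
- move=> a i e s b j; rewrite /= inE => nb.
  by rewrite /update (negPf nb).
- move=> c1 c2 s k1 s1 k2 s2 _ IH1 _ IH2 a i; rewrite mem_cat negb_or => /andP[n1 n2].
  by rewrite IH2 // IH1.
- move=> e c1 c2 s k t _ IH a i; rewrite mem_cat negb_or => /andP[n1 n2].
  by apply: IH; case: ifP.
- by move=> e c s k1 s1 k2 s2 _ _ IH1 _ IH2 a i na; rewrite IH2 // IH1.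
Qed.

Section Wp.
Variable look : nat -> nat -> nat.

Definition wp (c : cmd) (s : store) (Q : nat -> store -> Prop) : Prop :=
  exists k t, exec look c s k t /\ Q k t.

(** The rule of consequence with a frame rule built in: arrays that [c] does not write are known to
    be unchanged. *)
Lemma wp_mono c s (P Q : nat -> store -> Prop) :
  wp c s P -> (forall k t, same_outside (writes c) s t -> P k t -> Q k t) -> wp c s Q.
Proof.
move=> [k [t [ex HP]]] imp; exists k, t; split=> //; apply: imp => //.
exact: exec_writes ex.
Qed.

Lemma wp_skip s (Q : nat -> store -> Prop) : Q 1 s -> wp CSkip s Q.
Proof. by move=> q; exists 1, s; split=> //; constructor. Qed.

Lemma wp_set a i e s (Q : nat -> store -> Prop) :
  Q (ecost i + ecost e).+1 (update s a (eval look s i) (eval look s e)) ->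
  wp (CSet a i e) s Q.
Proof. by move=> q; do 2!eexists; split; last exact: q; constructor. Qed.

Lemma wp_seq c1 c2 s (Q : nat -> store -> Prop) :
  wp c1 s (fun k1 s1 => wp c2 s1 (fun k2 => Q (k1 + k2))) -> wp (CSeq c1 c2) s Q.
Proof.
move=> [k1 [s1 [ex1 [k2 [s2 [ex2 q]]]]]]; exists (k1 + k2), s2; split=> //.
exact: exec_seq ex1 ex2.
Qed.

Lemma wp_setE a i e x y s (Q : nat -> store -> Prop) :
  eval look s i = x -> eval look s e = y ->
  Q (ecost i + ecost e).+1 (update s a x y) -> wp (CSet a i e) s Q.
Proof. by move=> <- <-; apply: wp_set. Qed.

Lemma wp_set_then a i e x y c s (Q : nat -> store -> Prop) :
  eval look s i = x -> eval look s e = y ->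
  wp c (update s a x y) (fun k => Q ((ecost i + ecost e).+1 + k)) ->
  wp (CSeq (CSet a i e) c) s Q.
Proof. by move=> Ex Ey q; apply/wp_seq/wp_setE; eauto. Qed.

Lemma wp_if e c1 c2 s (Q : nat -> store -> Prop) :
  (eval look s e <> 0 -> wp c1 s (fun k => Q (ecost e + k).+1)) ->
  (eval look s e = 0 -> wp c2 s (fun k => Q (ecost e + k).+1)) ->
  wp (CIf e c1 c2) s Q.
Proof.
move=> q1 q2; have [E|ne] := eqVneq (eval look s e) 0.
  have [k [t [ex q]]] := q2 E; exists (ecost e + k).+1, t; split=> //.
  by apply: exec_if; rewrite E eqxx.
have [k [t [ex q]]] := q1 (elimN eqP ne); exists (ecost e + k).+1, t; split=> //.
by apply: exec_if; rewrite ne.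
Qed.

Definition var (a : nat) : expr := EGet a (EConst 0).

Definition for_upto (i b : nat) (c : cmd) : cmd :=
  CSeq (CSet i (EConst 0) (EConst 0))
    (CWhile (ESub (var b) (var i))
       (CSeq c (CSet i (EConst 0) (EAdd (var i) (EConst 1))))).

(* [Phi] is the budget that remains for the rest of the loop. *)
Lemma wp_for i b c s n (Inv : nat -> store -> Prop) (Phi : nat -> store -> nat) :
  s b 0 = n -> i \notin writes c -> b \notin i :: writes c ->
  Inv 0 (update s i 0 0) ->
  (forall j t, j < n -> same_outside (i :: writes c) s t -> t i 0 = j -> Inv j t ->
     wp c t (fun k t' => Inv j.+1 (update t' i 0 j.+1) /\
       k + 12 + Phi j.+1 (update t' i 0 j.+1) <= Phi j t)) ->
  wp (for_upto i b c) s (fun k t => Inv n t /\ k + Phi n t <= 9 + Phi 0 (update s i 0 0)).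
Proof.
move=> sb ni nb inv0 step; apply/wp_seq/wp_set => /=.
(* A round costs 5 for the guard, 6 for the increment and 1 for the loop rule; the 9 outside
   consists of 3 for the initialisation and 6 for the last test. *)
suff loop d j t : j + d = n -> same_outside (i :: writes c) s t -> t i 0 = j -> Inv j t ->
    wp (CWhile (ESub (var b) (var i))
         (CSeq c (CSet i (EConst 0) (EAdd (var i) (EConst 1))))) t
       (fun k t' => Inv n t' /\ k + Phi n t' <= 6 + Phi j t).
  apply: wp_mono (loop n 0 _ _ _ _ inv0) _ => //.
    by move=> a l; rewrite inE negb_or /update => /andP[/negPf->].
  by rewrite /update !eqxx.
elim: d j t => [|d IH] j t dn fr tj inv.
  have E : j = n by lia.
  exists 6, t; split; last by rewrite -E; split.
  by apply: exec_while_stop => /=; rewrite fr // sb tj E subnn.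
have lt : j < n by lia.
have [k [t' [ex [inv' le]]]] := step j t lt fr tj inv.
have fr' := exec_writes ex; set t2 := update t' i 0 j.+1 in inv' le.
have t'i : t' i 0 = j by rewrite fr' // tj.
have [|||k2 [t3 [ex2 [inv3 le3]]]] := IH j.+1 t2 _ _ _ inv'; first by lia.
- move=> a l; rewrite inE negb_or /t2 /update => /andP[/negPf na na'].
  by rewrite na /= fr' // fr // inE na.
- by rewrite /t2 /update !eqxx.
exists (5 + (k + 6) + k2).+1, t3; split; last by split=> //; lia.
apply: (exec_while_step _ _ ex2).
  by rewrite /= fr // sb tj subn_eq0 -ltnNge.
apply: exec_seq ex _.
have -> : t2 = update t' i (eval look t' (EConst 0)) (eval look t' (EAdd (var i) (EConst 1))).
  by rewrite /= t'i addn1.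
exact: exec_set.
Qed.

End Wp.

(** * The algorithm *)

(* Arrays: 0 holds n; 1, 2 the output; 3 the row offsets that make [at2 m x y] the
   cell (x, y) of the matrix stored in array m; 4, 5, 6 the queue of the search, its
   length and the visited vertices; 7 and 8 the temporal and static distances; 9, 10,
   11, 12 the [W], [A], [B], [S] of [tables]; 13 to 21 scalars. *)
Definition at2 (m : nat) (x y : expr) : expr := EGet m (EAdd (EGet 3 x) y).
Definition set2 (m : nat) (x y z : expr) : cmd := CSet m (EAdd (EGet 3 x) y) z.
(** A maximum, because subtraction is truncated. *)
Definition emax (x y : expr) : expr := EAdd x (ESub y x).
Definition zero : expr := EConst 0.
Definition one : expr := EConst 1.

(** Multiples of [n] by repeated addition, as the machine cannot multiply. *)
Definition rows : cmd :=
  for_upto 13 0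
    (CSet 3 (EAdd (var 13) one) (EAdd (EGet 3 (var 13)) (var 0))).

(** Distances between the new vertex in 14, whose parent is in 16, and the queue: the way to it is
    extended by [dt_step], the way from it is split at the parent by [dt_between]. *)
Definition attach : cmd :=
  for_upto 15 5
    (CSeq (CSet 18 zero (EGet 4 (var 15)))
    (CSeq (CSet 19 zero (EAdd (at2 8 (var 18) (var 16)) one))
    (CSeq (CSet 20 zero (emax (EAdd (at2 7 (var 18) (var 16)) one)
                              (ELookup (var 16) (var 14))))
    (CSeq (CSet 21 zero (emax (EAdd (ELookup (var 16) (var 14))
                                    (at2 8 (var 16) (var 18)))
                              (at2 7 (var 16) (var 18))))
    (CSeq (set2 8 (var 18) (var 14) (var 19))
    (CSeq (set2 8 (var 14) (var 18) (var 19))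
    (CSeq (set2 7 (var 18) (var 14) (var 20))
          (set2 7 (var 14) (var 18) (var 21))))))))).

Definition insert : cmd :=
  CSeq attach
  (CSeq (CSet 6 (var 14) one)
  (CSeq (CSet 4 (var 5) (var 14))
        (CSet 5 zero (EAdd (var 5) one)))).

Definition bfs_row : cmd :=
  for_upto 14 0
    (CIf (ELookup (var 16) (var 14))
      (CIf (ESub one (EGet 6 (var 14))) insert CSkip)
      CSkip).

Definition bfs : cmd :=
  CSeq (CSet 6 zero one)
  (CSeq (CSet 5 zero one)
    (for_upto 13 0
      (CSeq (CSet 16 zero (EGet 4 (var 13)))
        bfs_row))).

Definition count : cmd :=
  CSeq (CSet 17 zero zero)
    (for_upto 15 0
      (CIf (ESub (at2 7 (var 13) (var 15)) (at2 7 (var 14) (var 15)))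
        (CSet 17 zero (EAdd (var 17) one))
        CSkip)).

(** The outer guard is the test of [mem_halftreeE]: it selects the vertices from which the edge
    points away. *)
Definition record : cmd :=
  for_upto 15 0
    (CIf (ESub (at2 8 (var 15) (var 14)) (at2 8 (var 15) (var 13)))
      (CSeq (set2 9 (var 15) (var 14) (var 17))
      (CSeq (set2 10 (var 15) (var 14) (ELookup (var 13) (var 14)))
        (CIf (ESub (var 17) (EGet 11 (var 15)))
          (CSeq (CSet 11 (var 15) (var 17)) (CSet 12 (var 15) (var 14)))
          CSkip)))
      CSkip).

Definition fill_row : cmd :=
  for_upto 14 0 (CIf (ELookup (var 13) (var 14)) (CSeq count record) CSkip).

Definition fill : cmd := for_upto 13 0 fill_row.

(* The guard vanishes unless the output is certified; [X - (X - Z)] is [min X Z]. *)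
Definition search : cmd :=
  let q := var 13 in let y := var 14 in let s := EGet 12 y in
  let X := ESub (EGet 11 y) (at2 9 y q) in
  let Z := EAdd (ESub (at2 7 q y) (at2 10 q y))
                (ESub (EAdd (at2 8 y s) (at2 8 s q)) (at2 8 y q)) in
  for_upto 13 0 (for_upto 14 0
    (CIf (ESub one (EAdd (ESub (EGet 11 q) (at2 9 q y)) (ESub X (ESub X Z))))
      (CSeq (CSet 1 zero q) (CSet 2 zero y))
      CSkip)).

Definition nash_program : cmd := CSeq rows (CSeq bfs (CSeq fill search)).

(* Kept folded, as simplification would change the implicit arguments of its body. *)
Definition rank (V : finType) (v : V) : nat := enum_rank v.
Arguments rank : simpl never.

(** * Correctness and running time of the program *)

Section Correctness.
Variables (V : finType) (T : temporal_graph V) (look : nat -> nat -> nat).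
Hypotheses (tree : temporal_tree T) (mono : monotonically_growing T).
Hypothesis lookup : lookup_table T look.
Local Notation e := (underlying T).
Local Notation H := (halftree e).
Local Notation a := (first_time T).
Local Notation dist := (dist T).
Local Notation dt := (dt T).
(* A variable, because simplification changes the form of [#|V|]. *)
Variables (n : nat) (nE : n = #|V|).
Local Notation r := (@rank V).
Local Notation ix u v := (r u * n + r v).
Implicit Types u v w x y z : V.

Let eC : symmetric e := underlying_sym T.
Let eirr : irreflexive e := underlying_irr T.

Lemma lookE u v : look (r u) (r v) = if e u v then a u v else 0.
Proof.
have := lookup u v; case: ifP => // _.
exact: first_time_unique.
Qed.

Lemma look_edge u v : look (r u) (r v) <> 0 <-> e u v.
Proof. by rewrite lookE; case: ifP => // /first_time_gt0; split=> //; lia. Qed.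

Lemma rank_inj u v : r u = r v -> u = v.
Proof. by move=> E; apply/enum_rank_inj/val_inj. Qed.

Lemma rank_eq u v : (r u == r v) = (u == v).
Proof. by apply/eqP/eqP => [/rank_inj|->]. Qed.

Lemma rank_lt u : r u < n.
Proof. by rewrite nE; exact: ltn_ord. Qed.

Lemma rank_onto j : j < n -> exists v : V, j = r v.
Proof. by rewrite nE => lt; exists (enum_val (Ordinal lt)); rewrite /rank enum_valK. Qed.

Lemma ix_eq u v x y : (ix u v == ix x y) = (u == x) && (v == y).
Proof.
apply/eqP/andP => [E|[/eqP-> /eqP-> //]].
have lt := rank_lt.
have Ed w z : ix w z %/ n = r w.
  by rewrite divnMDl ?divn_small ?addn0 //; have := lt w; lia.
have Em w z : ix w z %% n = r z by rewrite modnMDl modn_small.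
by rewrite -!rank_eq; split; apply/eqP; [rewrite -(Ed u v) E Ed | rewrite -(Em u v) E Em].
Qed.

Definition indexed (s : store) : Prop := s 0 0 = n /\ forall u, s 3 (r u) = r u * n.

Lemma rows_spec s : s 0 0 = n -> s 3 0 = 0 ->
  wp look rows s (fun k t => indexed t /\ k <= 9 + 23 * n).
Proof.
move=> s0 s3.
pose Inv j (t : store) := forall i, i <= j -> t 3 i = i * n.
apply: (wp_mono (@wp_for look 13 0 _ s n Inv (fun j _ => 23 * (n - j)) s0 _ _ _ _)) => //.
- by move=> i; rewrite leqn0 => /eqP->.
- move=> j t lt fr tj inv; apply: wp_set => /=; split; last lia.
  have t0 : t 0 0 = n by rewrite fr.
  move=> i le; rewrite /update /= tj addn1 t0.
  case: eqP => [->|ne]; first by rewrite inv // mulSn addnC.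
  by apply: inv; lia.
move=> k t fr [inv le]; split; last lia.
split; first by rewrite fr.
by move=> u; apply: (inv (r u)); apply/ltnW/rank_lt.
Qed.

Definition correct (P : V -> V -> bool) (t : store) : Prop :=
  forall u v, P u v -> t 7 (ix u v) = dt u v /\ t 8 (ix u v) = dist u v.

Lemma attach_spec s z qs u w : indexed s -> s 5 0 = size qs ->
  (forall k, k < size qs -> s 4 k = r (nth z qs k)) -> s 16 0 = r u -> s 14 0 = r w ->
  u \in qs -> w \notin qs -> e u w -> (forall v, v \in qs -> v \notin H u w) ->
  correct (fun x y => [|| (x \in qs) && (y \in qs) | x == y]) s ->
  wp look attach s (fun k t =>
    correct (fun x y => [|| (x \in w :: qs) && (y \in w :: qs) | x == y]) t /\
    k <= 9 + 150 * size qs).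
Proof.
move=> [s0 s3] s5 s4 s16 s14 uqs wqs euw away ok.
(* After [k] rounds the pairs of [w] with the first [k] queue entries are right; diagonal cells are
   not touched by the loop. *)
pose Inv k t := correct (fun x y =>
  [|| (x \in qs) && (y \in qs), x == y, (y == w) && (x \in take k qs)
    | (x == w) && (y \in take k qs)]) t.
apply: (wp_mono (@wp_for look 15 5 _ s _ Inv (fun j _ => 150 * (size qs - j)) s5 _ _ _ _)) => //.
- by move=> x y; rewrite take0 !in_nil !andbF !orbF; apply: ok.
- move=> j t lt fr tj inv.
  have tq : t 4 j = r (nth z qs j) by rewrite fr // s4.
  have vqs := mem_nth z lt; have tk := take_nth z lt.
  move: (nth z qs j) tq vqs tk => v tq vqs tk.
  have t3 x : t 3 (r x) = r x * n by rewrite fr // s3.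
  have t16 : t 16 0 = r u by rewrite fr.
  have t14 : t 14 0 = r w by rewrite fr.
  have [|t7vu t8vu] := inv v u; first by rewrite vqs uqs.
  have [|t7uv t8uv] := inv u v; first by rewrite vqs uqs.
  have luw : look (r u) (r w) = a u w by rewrite lookE euw.
  apply: (@wp_set_then _ _ _ _ 0 (r v)) => //; first by rewrite /= tj.
  apply: (@wp_set_then _ _ _ _ 0 (dist v u).+1) => //.
    by rewrite /update /= t16 t3 t8vu addn1.
  apply: (@wp_set_then _ _ _ _ 0 (maxn (dt v u).+1 (a u w))) => //.
    by rewrite /update /= t16 t14 t3 t7vu luw addn1 maxnE.
  apply: (@wp_set_then _ _ _ _ 0 (maxn (a u w + dist u v) (dt u v))) => //.
    by rewrite /update /= t16 t14 t3 t7uv t8uv luw maxnE.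
  apply: (@wp_set_then _ _ _ _ (ix v w) (dist v u).+1) => //.
    by rewrite /update /= t14 t3.
  apply: (@wp_set_then _ _ _ _ (ix w v) (dist v u).+1) => //.
    by rewrite /update /= t14 t3.
  apply: (@wp_set_then _ _ _ _ (ix v w) (maxn (dt v u).+1 (a u w))) => //.
    by rewrite /update /= t14 t3.
  apply: (@wp_setE _ _ _ _ (ix w v) (maxn (a u w + dist u v) (dt u v))) => //.
    by rewrite /update /= t14 t3.
  split; last by move: lt; rewrite /=; lia.
  have nv := away _ vqs; have ewu : e w u by rewrite eC.
  have dvw := dt_step tree mono euw nv.
  have lvw := dist_step tree euw nv.
  have dwv : dt w v = maxn (a u w + dist u v) (dt u v).
    rewrite (@dt_between _ _ tree mono w u v) ?(dt_nbr tree mono ewu) 1?first_timeC //.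
    apply: halftree_between_head ewu (tail_halftree eirr tree ewu) _ => //.
    by rewrite (halftreeC eC eirr tree euw) in_setC.
  have lwv : dist w v = (dist v u).+1 by rewrite dist_sym.
  move=> x y; rewrite /update /= !ix_eq tk !mem_rcons !inE => old.
  have [/andP[/eqP-> /eqP->]|nxy] := boolP ((x == w) && (y == v)); first by split.
  have [/andP[/eqP-> /eqP->]|nyx] := boolP ((x == v) && (y == w)); first by split.
  apply: inv; case/or4P: old => [-> //|->|/andP[yw]|/andP[xw]]; rewrite ?orbT //.
    by rewrite yw andbT in nyx; rewrite (negPf nyx) yw /= => ->; rewrite !orbT.
  by rewrite xw /= in nxy; rewrite (negPf nxy) xw /= => ->; rewrite !orbT.
move=> k t _ [inv le]; split; last lia.
move=> x y old; apply: inv; rewrite take_size; move: old; rewrite !inE.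
case: (eqVneq x w) => [->|_]; case: (eqVneq y w) => [->|_] //=; rewrite ?eqxx ?orbT //=;
  by case: (x \in qs); case: (y \in qs); rewrite ?orbT ?orbF ?andbF ?andbT.
Qed.

Definition visited z (qs : seq V) : rel V :=
  [rel x y | [&& e x y, x \in [set v in qs] & y \in [set v in qs]]].

(* The ghost list [qs] is the queue of the search that starts at [z]. *)
Record reached (z : V) (qs : seq V) (t : store) : Prop := Reached {
  reached_uniq : uniq qs;
  reached_size : t 5 0 = size qs;
  reached_queue : forall k, t 4 k = r (nth z qs k);
  reached_seen : forall v, t 6 (r v) = (v \in qs);
  reached_root : z \in qs;
  reached_connect : forall v, v \in qs -> connect (visited z qs) z v;
  reached_correct : correct (fun x y => [|| (x \in qs) && (y \in qs) | x == y]) t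
}.

Lemma uniq_size (qs : seq V) : uniq qs -> size qs <= n.
Proof. by move=> /card_uniqP <-; rewrite nE; exact: max_card. Qed.

Lemma insert_spec s z qs u w : indexed s -> reached z qs s -> s 16 0 = r u ->
  s 14 0 = r w -> u \in qs -> w \notin qs -> e u w ->
  wp look insert s (fun k t => reached z (rcons qs w) t /\ k <= 200 * n).
Proof.
move=> ixs re s16 s14 uqs wqs euw.
have sz : size qs < n.
  by have := @uniq_size (w :: qs); rewrite /= wqs (reached_uniq re) => /(_ isT).
have away v : v \in qs -> v \notin H u w.
  move=> vqs; apply: (@connect_restrict_halftree _ _ eC eirr tree [set v in qs]);
    rewrite ?inE //.
  apply: connect_trans (reached_connect re vqs).
  rewrite (@sym_connect_sym _ (visited z qs)); first exact: (reached_connect re uqs).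
  by move=> x y; rewrite /visited /= eC [(x \in _) && _]andbC.
apply/wp_seq; apply: (wp_mono (@attach_spec _ z qs u w ixs (reached_size re)
  (fun k _ => reached_queue re k) s16 s14 uqs wqs euw away (reached_correct re))).
move=> k t fr [ok le].
have t14 : t 14 0 = r w by rewrite fr.
have t5 : t 5 0 = size qs by rewrite fr // (reached_size re).
apply: (@wp_set_then _ _ _ _ (r w) 1) => //.
apply: (@wp_set_then _ _ _ _ (size qs) (r w)) => //.
apply: (@wp_setE _ _ _ _ 0 (size qs).+1) => //.
  by rewrite /update /= t5 addn1.
split; last by move: le; rewrite /=; lia.
split=> /=.
- by rewrite rcons_uniq wqs (reached_uniq re).
- by rewrite size_rcons.
- move=> j; rewrite /update /= fr // (reached_queue re) nth_rcons.
  case: ltngtP => // gt; last by rewrite nth_default //; apply: ltnW.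
- move=> v; rewrite /update /= fr // (reached_seen re) mem_rcons inE rank_eq.
  by case: (v == w).
- by rewrite mem_rcons inE (reached_root re) orbT.
- move=> v; rewrite mem_rcons inE => vq.
  have sub x : x \in qs -> connect (visited z (rcons qs w)) z x.
    move=> /(reached_connect re); apply: connect_sub => b c /and3P[ebc bq cq].
    apply: connect1; rewrite /visited /= ebc !inE !mem_rcons !inE.
    by move: bq cq; rewrite !inE => -> ->; rewrite !orbT.
  case/predU1P: vq => [->|]; last exact: sub.
  apply: connect_trans (sub _ uqs) (connect1 _).
  by rewrite /visited /= euw !inE !mem_rcons !inE uqs eqxx orbT.
- by move=> x y; rewrite !mem_rcons; apply: ok.
Qed.

(** The number of unvisited vertices serves as a potential: each of them pays once for its own
    insertion, which takes linear time, so a row by itself costs only its scan. *)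
Lemma bfs_row_spec s z qs u : indexed s -> reached z qs s -> s 16 0 = r u -> u \in qs ->
  wp look bfs_row s (fun k t => (exists2 qs', reached z (qs ++ qs') t &
      forall w, e u w -> w \in qs ++ qs') /\
    k + 300 * n * (n - t 5 0) <= 9 + 100 * n + 300 * n * (n - s 5 0)).
Proof.
move=> [s0 s3] re s16 uqs.
pose Inv j t := exists2 qs', reached z (qs ++ qs') t &
  forall w, r w < j -> e u w -> w \in qs ++ qs'.
pose Phi j (t : store) := 100 * (n - j) + 300 * n * (n - t 5 0).
apply: (wp_mono (@wp_for look 14 0 _ s n Inv Phi s0 _ _ _ _)) => //.
- by exists [::]; rewrite ?cats0 //; case: re => *; split.
- move=> j t lt fr tj [qs' ret don].
  have [w Ew] := rank_onto lt; rewrite {}Ew in tj lt don *.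
  have t16 : t 16 0 = r u by rewrite fr.
  have luw : eval look t (ELookup (var 16) (var 14)) = look (r u) (r w).
    by rewrite /= t16 tj.
  have skip (k : nat) : k <= 20 -> (e u w -> w \in qs ++ qs') ->
      Inv (r w).+1 (update t 14 0 (r w).+1) /\
      k + 12 + Phi (r w).+1 (update t 14 0 (r w).+1) <= Phi (r w) t.
    move=> k20 old; split; last by move: lt; rewrite /Phi /update /=; lia.
    exists qs'; first by case: ret => *; split.
    move=> v; rewrite ltnS leq_eqVlt => /predU1P[/rank_inj->|]; first exact: old.
    exact: don.
  apply: wp_if; rewrite luw; last by move=> nuw; apply/wp_skip/skip => // /look_edge.
  move=> /look_edge euw.
  have [wq|wq] := boolP (w \in qs ++ qs').
    apply: wp_if; first by rewrite /= tj (reached_seen ret) wq.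
    by move=> _; apply/wp_skip/skip.
  apply: wp_if; last by rewrite /= tj (reached_seen ret) (negPf wq).
  move=> _; have uq : u \in qs ++ qs' by rewrite mem_cat uqs.
  have ixt : indexed t by split=> [|v]; rewrite fr.
  apply: (wp_mono (insert_spec ixt ret t16 tj uq wq euw)) => k t' fr' [ret' le].
  split.
    exists (rcons qs' w); rewrite -rcons_cat; first by case: ret' => *; split.
    move=> v; rewrite ltnS leq_eqVlt mem_rcons inE => /predU1P[/rank_inj->|lt' euv].
      by rewrite eqxx.
    by rewrite (don v) ?orbT.
  have sz := uniq_size (reached_uniq ret'); rewrite size_rcons in sz.
  rewrite /Phi /update /= (reached_size ret) (reached_size ret') size_rcons.
  have -> : n - size (qs ++ qs') = (n - (size (qs ++ qs')).+1).+1 by lia.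
  rewrite mulnS; move: (300 * n * (n - _)) lt le => m; lia.
move=> k t fr [[qs' ret don] le]; split; last first.
  by move: le; rewrite /Phi /update /=; lia.
by exists qs' => // w; apply/don/rank_lt.
Qed.

Lemma closed_all (z : V) (qs : seq V) : z \in qs ->
  (forall v, v \in qs -> forall w, e v w -> w \in qs) -> forall v, v \in qs.
Proof.
move=> zq cl v; have [_ conn _] := tree.
have clo : closed e [pred x | x \in qs].
  apply: intro_closed; first exact: sym_connect_sym.
  by move=> x y exy xq; apply: cl exy.
by have := closed_connect clo (conn z v); rewrite !inE zq.
Qed.

Lemma bfs_spec s : 0 < n -> indexed s -> (forall k, s 4 k = 0) ->
  (forall k, s 6 k = 0) -> (forall k, s 7 k = 0) -> (forall k, s 8 k = 0) ->
  wp look bfs s (fun k t => correct (fun _ _ => true) t /\ k <= 600 * n ^ 2).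
Proof.
move=> npos ixs s4 s6 s7 s8; have [z z0] := rank_onto npos.
apply: (@wp_set_then _ _ _ _ 0 1) => //; apply: (@wp_set_then _ _ _ _ 0 1) => //.
set t0 := update _ 5 0 1.
have ix0 : indexed t0 by case: ixs.
have re0 : reached z [:: z] t0.
  split=> //.
  - by case=> [|k]; rewrite /t0 /update /= s4 -?z0 //= nth_nil -z0.
  - by move=> v; rewrite /t0 /update /= s6 inE -(rank_eq v z) -z0; case: (r v == 0).
  - by rewrite inE.
  - by move=> v; rewrite inE => /eqP->; apply: connect0.
  move=> x y; rewrite !inE => xy; have -> : x = y.
    by case/orP: xy => [/andP[/eqP-> /eqP->]|/eqP].
  by rewrite /t0 /update /= s7 s8 dtxx distxx.
move: t0 ix0 re0 => t0 [t00 t03] re0.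
pose Inv i t := exists2 qs, reached z qs t &
  forall k, k < i -> forall w, e (nth z qs k) w -> w \in qs.
pose Phi i (t : store) := (100 * n + 40) * (n - i) + 300 * n * (n - t 5 0).
apply: (wp_mono (@wp_for look 13 0 _ t0 n Inv Phi t00 _ _ _ _)) => //.
- by exists [:: z] => //; case: re0 => *; split.
- move=> i t lt fr ti [qs ret don].
  (* The queue is never exhausted early: if all its entries were expanded, it would be closed under
     adjacency, hence contain all [n] vertices. *)
  have szi : i < size qs.
    rewrite ltnNge; apply/negP => le.
    have all : forall v, v \in qs.
      apply: (closed_all (reached_root ret)) => v vq; rewrite -(nth_index z vq).
      by apply: don; apply: leq_trans le; rewrite index_mem.
    have : #|V| <= size qs.
      by rewrite cardE; apply: uniq_leq_size (enum_uniq _) _ => v _; exact: all.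
    by rewrite -nE => /leq_trans/(_ le); rewrite leqNgt lt.
  apply: (@wp_set_then _ _ _ _ 0 (r (nth z qs i))) => //.
    by rewrite /= ti (reached_queue ret).
  set t1 := update t 16 0 _.
  have ix1 : indexed t1 by split=> [|v]; rewrite /t1 /update /= fr.
  have re1 : reached z qs t1 by case: ret => *; split.
  apply: (wp_mono (bfs_row_spec ix1 re1 erefl (mem_nth z szi))).
  move=> k t' fr' [[qs' ret' don'] le]; split.
    exists (qs ++ qs'); first by case: ret' => *; split.
    move=> j; rewrite ltnS leq_eqVlt nth_cat => /predU1P[->|lt'].
      by rewrite szi.
    rewrite (ltn_trans lt' szi) => w /(don _ lt') wq.
    by rewrite mem_cat wq.
  move: le; rewrite /Phi /update /t1 /update /=.
  have -> : n - i = (n - i.+1).+1 by lia.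
  rewrite mulnS; move: (_ * (n - i.+1)) (_ * (n - t 5 0)) (_ * (n - t' 5 0)); lia.
move=> k t fr [[qs ret don] le]; split.
  have all : forall v, v \in qs.
    apply: (closed_all (reached_root ret)) => v vq; rewrite -(nth_index z vq).
    apply: don; apply: leq_trans (uniq_size (reached_uniq ret)).
    by rewrite index_mem.
  by move=> x y _; apply: (reached_correct ret); rewrite !all.
move: le; rewrite /Phi /update /= (reached_size re0) /=; nia.
Qed.

(** * Payoffs against neighbours and best responses *)

Lemma count_spec s x y : indexed s -> correct (fun _ _ => true) s ->
  s 13 0 = r x -> s 14 0 = r y ->
  wp look count s (fun k t => t 17 0 = payoff T y x /\ k <= 12 + 50 * n).
Proof.
move=> [s0 s3] ok s13 s14.
apply: (@wp_set_then _ _ _ _ 0 0) => //.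
set t0 := update s 17 0 0; have t00 : t0 0 0 = n by [].
pose Inv j (t : store) := t 17 0 = #|[set v in wins T y x | r v < j]|.
apply: (wp_mono (@wp_for look 15 0 _ t0 n Inv (fun j _ => 50 * (n - j)) t00 _ _ _ _)) => //.
- rewrite /Inv /t0 /update /=; apply/esym/eqP; rewrite cards_eq0 -subset0.
  by apply/subsetP => v; rewrite !inE andbF.
- move=> j t lt fr tj inv; have [v Ev] := rank_onto lt; rewrite {}Ev in tj lt inv *.
  have t3 z : t 3 (r z) = r z * n by rewrite fr // /t0 /update /= s3.
  have t13 : t 13 0 = r x by rewrite fr.
  have t14 : t 14 0 = r y by rewrite fr.
  have t7 z : t 7 (ix z v) = dt z v by rewrite fr //; have [] := ok z v isT.
  have guard : eval look t (ESub (at2 7 (var 13) (var 15)) (at2 7 (var 14) (var 15))) =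
      dt x v - dt y v by rewrite /= t13 t14 tj !t3 !t7.
  have cardS : #|[set u in wins T y x | r u < (r v).+1]| =
      (v \in wins T y x) + #|[set u in wins T y x | r u < r v]|.
    rewrite (cardsD1 v) inE ltnSn andbT; congr (_ + _); apply: eq_card => u.
    rewrite !inE ltnS [r u <= _]leq_eqVlt rank_eq.
    by case: (eqVneq u v) => [->|//]; rewrite ltnn andbF.
  apply: wp_if; rewrite guard => win.
    apply: (@wp_setE _ _ _ _ 0 (t 17 0).+1) => //; first by rewrite /= addn1.
    split; last by move: lt; rewrite /=; lia.
    by rewrite /Inv /update /= cardS inv inE -subn_gt0 lt0n (introN eqP win).
  apply: wp_skip; split; last by move: lt; rewrite /=; lia.
  by rewrite /Inv /update /= cardS inv inE -subn_gt0 win.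
move=> k t fr [inv le]; split; last by move: le; rewrite /=; lia.
rewrite inv payoffE //; apply: eq_card => v.
by rewrite !inE rank_lt andbT.
Qed.

(** The invariant that becomes [tables]: [P] marks the triples treated so far, and array 12 holds
    the number of a vertex at every stage. *)
Record filled (P : V -> V -> V -> bool) (t : store) : Prop := Filled {
  filled_edge : forall v x y, P v x y -> e x y -> v \notin H x y ->
    [/\ t 9 (ix v y) = payoff T y x, t 10 (ix v y) = a x y
      & payoff T y x <= t 11 (r v)];
  filled_diag : forall v, t 9 (ix v v) = 0;
  filled_best : forall v, exists s, t 12 (r v) = r s /\
    (t 11 (r v) = 0 \/
     exists q, [/\ e q s, v \notin H q s & payoff T s q = t 11 (r v)])
}.

Lemma filled_sub (P Q : V -> V -> V -> bool) t :
  (forall v x y, e x y -> v \notin H x y -> Q v x y -> P v x y) ->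
  filled P t -> filled Q t.
Proof.
move=> sub [fe fd fb]; split=> // v x y q exy nv; apply: fe => //; exact: sub.
Qed.

Lemma filled_step (P : V -> V -> V -> bool) t t' v x y :
  filled P t -> e x y -> v \notin H x y ->
  (forall i, t' 9 i = if i == ix v y then payoff T y x else t 9 i) ->
  (forall i, t' 10 i = if i == ix v y then a x y else t 10 i) ->
  (forall i, t' 11 i = if (i == r v) && (t 11 (r v) < payoff T y x)
                       then payoff T y x else t 11 i) ->
  (forall i, t' 12 i = if (i == r v) && (t 11 (r v) < payoff T y x)
                       then r y else t 12 i) ->
  filled (fun v' x' y' => [|| P v' x' y' | [&& v' == v, x' == x & y' == y]]) t'.
Proof.
move=> [fe fd fb] exy nv t9 t10 t11 t12.
have yv : y != v by apply: contraNneq nv => <-; exact: head_halftree.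
split.
- move=> v' x' y' old ex'y' nv'; rewrite t9 t10 t11 ix_eq rank_eq.
  have [Ev|nev] /= := eqVneq v' v; last first.
    by rewrite (negPf nev) orbF in old; apply: fe.
  rewrite {}Ev in nv' old *; rewrite eqxx /= in old.
  have [Ey|ney] := eqVneq y' y; last first.
    rewrite (negPf ney) andbF orbF in old; have [-> -> le] := fe _ _ _ old ex'y' nv'.
    by split=> //; case: ifP => // lt; apply: leq_trans le (ltnW lt).
  rewrite {}Ey in ex'y' nv' *.
  (* Cells are indexed by [v] and the head only; as the predecessor on the path from [v] is unique,
     no two edges share a cell. *)
  have -> : x' = x by apply: prev_vertex_unique eC eirr tree _ _ _ _ ex'y' exy nv' nv.
  by split=> //; case: ltnP.
- move=> u; rewrite t9 ix_eq; case: eqVneq => [->|_] /=; last exact: fd.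
  by rewrite eq_sym (negPf yv) fd.
move=> u; rewrite t11 t12 rank_eq.
have [Eu|ne] := eqVneq u v; last exact: fb.
rewrite {}Eu /=; case: ifP => lt; last exact: fb.
by exists y; split=> //; right; exists x.
Qed.

Lemma record_spec s x y P : indexed s -> correct (fun _ _ => true) s ->
  s 13 0 = r x -> s 14 0 = r y -> s 17 0 = payoff T y x -> e x y -> filled P s ->
  wp look record s (fun k t =>
    filled (fun v' x' y' => [|| P v' x' y' | [&& x' == x & y' == y]]) t /\
    k <= 9 + 100 * n).
Proof.
move=> [s0 s3] ok s13 s14 s17 exy fil.
pose Inv j t := filled
  (fun v' x' y' => [|| P v' x' y' | [&& r v' < j, x' == x & y' == y]]) t.
apply: (wp_mono (@wp_for look 15 0 _ s n Inv (fun j _ => 100 * (n - j)) s0 _ _ _ _)) => //.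
- have : Inv 0 s by apply: filled_sub fil => v' x' y' _ _; rewrite ltn0 orbF.
  by case=> *; split.
- move=> j t lt fr tj inv; have [v Ev] := rank_onto lt; rewrite {}Ev in tj lt inv *.
  have t3 z : t 3 (r z) = r z * n by rewrite fr // s3.
  have t13 : t 13 0 = r x by rewrite fr.
  have t14 : t 14 0 = r y by rewrite fr.
  have t17 : t 17 0 = payoff T y x by rewrite fr.
  have t8 z : t 8 (ix v z) = dist v z by rewrite fr //; have [] := ok v z isT.
  have lxy : look (r x) (r y) = a x y by rewrite lookE exy.
  have guard : eval look t (ESub (at2 8 (var 15) (var 14)) (at2 8 (var 15) (var 13))) =
      dist v y - dist v x by rewrite /= t13 t14 tj !t3 !t8.
  apply: wp_if; rewrite guard => side; last first.
    apply: wp_skip; split; last by move: lt; rewrite /=; lia.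
    have : Inv (r v).+1 t.
      apply: filled_sub inv => v' x' y' _ nv' /orP[->//|/and3P[le /eqP Ex /eqP Ey]].
      rewrite Ex Ey !eqxx !andbT in nv' *; apply/orP; right.
      rewrite ltn_neqAle -ltnS le andbT rank_eq; apply: contraNneq nv' => ->.
      by apply/negPn/negP => nv; have := dist_step tree exy nv; lia.
    by case=> *; split.
  have nv : v \notin H x y by rewrite (mem_halftreeE tree _ exy); lia.
  apply: (@wp_set_then _ _ _ _ (ix v y) (payoff T y x)) => //.
    by rewrite /= tj t14 t3.
  apply: (@wp_set_then _ _ _ _ (ix v y) (a x y)) => //.
  + by rewrite /update /= tj t14 t3.
  + by rewrite /update /= t13 t14 lxy.
  have step t' : filled (fun v' x' y' =>
      [|| P v' x' y' || [&& r v' < r v, x' == x & y' == y]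
        | [&& v' == v, x' == x & y' == y]]) t' -> Inv (r v).+1 t'.
    apply: filled_sub => v' x' y' _ _; rewrite ltnS leq_eqVlt rank_eq.
    by case/orP=> [->//|]; case/andP=> /orP[->|->] /andP[-> ->]; rewrite /= ?orbT.
  apply: wp_if => [gain|nogain].
    apply: (@wp_set_then _ _ _ _ (r v) (payoff T y x)) => //.
    apply: (@wp_setE _ _ _ _ (r v) (r y)) => //.
    rewrite /= /update /= tj t17 in gain.
    have lt' : t 11 (r v) < payoff T y x by lia.
    split; last by move: lt; rewrite /=; lia.
    by apply/step/(filled_step inv exy nv) => i; rewrite /update /= ?lt' ?andbT.
  rewrite /= /update /= tj t17 in nogain.
  have lt' : (t 11 (r v) < payoff T y x) = false by lia.
  apply: wp_skip; split; last by move: lt; rewrite /=; lia.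
  by apply/step/(filled_step inv exy nv) => i; rewrite /update /= ?lt' ?andbF.
move=> k t fr [inv le]; split; last by move: le; rewrite /=; lia.
by apply: filled_sub inv => v x' y' _ _; rewrite rank_lt.
Qed.

(** The directed edges still ahead of a row-by-row scan that has arrived at position [m]. This is
    the potential for filling the tables, where only edges cause linear work. *)
Definition edges_from (m : nat) : nat :=
  #|[set d : V * V | e d.1 d.2 && (m <= ix d.1 d.2)]|.

Lemma edges_from_step x y :
  edges_from (ix x y) = e x y + edges_from (ix x y).+1.
Proof.
rewrite /edges_from (cardsD1 (x, y)) !inE /= leqnn andbT; congr (_ + _).
apply: eq_card => -[u v]; rewrite !inE /= [ix x y <= _]leq_eqVlt eq_sym ix_eq xpair_eqE.
case: (eqVneq u x) => [->|_] //=; case: (eqVneq v y) => [->|_] //=.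
by rewrite ltnn andbF.
Qed.

(* Each vertex is the far end, seen from [z], of at most one edge. *)
Lemma edges_from0 : edges_from 0 <= 2 * n.
Proof.
have [/card_gt0P[z _] _ _] := tree.
rewrite /edges_from; set E := [set d | _].
rewrite -(cardsID [set d | z \in H d.1 d.2] E) mul2n -addnn nE.
have far d1 d2 : e d1.1 d1.2 -> e d2.1 d2.2 -> z \notin H d1.1 d1.2 ->
    z \notin H d2.1 d2.2 -> d1.2 = d2.2 -> d1 = d2.
  case: d1 d2 => [x y] [x' y'] /= exy ex'y' nz nz' Ey; rewrite -{}Ey in ex'y' nz' *.
  by rewrite (prev_vertex_unique eC eirr tree exy ex'y' nz nz').
apply: leq_add.
  rewrite -(@card_in_imset _ _ fst); first exact: max_card.
  move=> [x y] [x' y']; rewrite !in_setI !in_set /= => /andP[/andP[exy _] hz].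
  move=> /andP[/andP[ex'y' _] hz'] Ex.
  suff [-> ->] : (y, x) = (y', x') by [].
  apply: far => //=.
  - by rewrite eC.
  - by rewrite eC.
  - by rewrite (halftreeC eC eirr tree exy) in_setC negbK in_set.
  by rewrite (halftreeC eC eirr tree ex'y') in_setC negbK in_set.
rewrite -(@card_in_imset _ _ snd); first exact: max_card.
move=> d1 d2; rewrite !in_setD !in_set => /andP[nz /andP[e1 _]] /andP[nz' /andP[e2 _]].
by apply: far; rewrite ?in_set.
Qed.

Lemma fill_row_spec s x P : indexed s -> correct (fun _ _ => true) s -> s 13 0 = r x ->
  filled P s ->
  wp look fill_row s (fun k t => filled (fun v' x' y' => P v' x' y' || (x' == x)) t /\
    k + 200 * n * edges_from (r x * n + n) <= 9 + 40 * n + 200 * n * edges_from (r x * n)).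
Proof.
move=> [s0 s3] ok s13 fil.
pose Inv j t := filled (fun v' x' y' => P v' x' y' || ((x' == x) && (r y' < j))) t.
pose Phi j (_ : store) := 40 * (n - j) + 200 * n * edges_from (r x * n + j).
apply: (wp_mono (@wp_for look 14 0 _ s n Inv Phi s0 _ _ _ _)) => //.
- have : Inv 0 s by apply: filled_sub fil => v' x' y' _ _; rewrite ltn0 andbF orbF.
  by case=> *; split.
- move=> j t lt fr tj inv; have [y Ey] := rank_onto lt; rewrite {}Ey in tj lt inv *.
  have t13 : t 13 0 = r x by rewrite fr.
  have ixt : indexed t by split=> [|v]; rewrite fr.
  have okt : correct (fun _ _ => true) t by move=> u v _; rewrite !fr //; apply: ok.
  have guard : eval look t (ELookup (var 13) (var 14)) = look (r x) (r y).
    by rewrite /= t13 tj.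
  have next t' : filled (fun v' x' y' =>
      [|| P v' x' y' || ((x' == x) && (r y' < r y)) | (x' == x) && (y' == y)]) t' ->
      Inv (r y).+1 t'.
    apply: filled_sub => v' x' y' _ _; rewrite ltnS leq_eqVlt rank_eq.
    by case/orP=> [->//|]; case/andP=> -> /orP[->|->]; rewrite /= ?orbT.
  rewrite {2}/Phi edges_from_step -addnS.
  apply: wp_if; rewrite guard.
    move=> /look_edge exy; apply: wp_seq; apply: (wp_mono (count_spec ixt okt t13 tj)) => k1 t1 fr1 [t1w le1].
    have ix1 : indexed t1 by case: ixt => t0 t3; split=> [|v]; rewrite fr1.
    have ok1 : correct (fun _ _ => true) t1.
      by move=> u v _; rewrite !fr1 //; apply: okt.
    have fil1 : filled (fun v' x' y' => P v' x' y' || ((x' == x) && (r y' < r y))) t1.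
      case: inv => fe fd fb; split=> *; rewrite !fr1 //; by [exact: fe | exact: fb].
    have t1x : t1 13 0 = r x by rewrite fr1.
    have t1y : t1 14 0 = r y by rewrite fr1.
    apply: (wp_mono (record_spec ix1 ok1 t1x t1y t1w exy fil1)) => k2 t2 fr2 [fil2 le2].
    split; first by case: (next _ fil2) => *; split.
    rewrite /Phi exy mulnDr muln1 /=.
    by move: (200 * n * edges_from _) le1 le2 lt => m; lia.
  move=> nxy; apply: wp_skip; split.
    have : Inv (r y).+1 t.
      apply/next/(filled_sub _ inv) => v' x' y' exy _ /orP[//|/andP[/eqP Ex /eqP Ey]].
      by move: nxy; rewrite Ex Ey in exy; move/look_edge: exy.
    by case=> *; split.
  rewrite /Phi mulnDr /=.
  by move: (200 * n * edges_from _) (200 * n * e x y) lt => m m'; lia.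
move=> k t fr [inv le]; split; last by move: le; rewrite /Phi addn0 /=; lia.
by apply: filled_sub inv => v x' y' _ _; rewrite rank_lt andbT.
Qed.

Lemma fill_spec s : indexed s -> correct (fun _ _ => true) s ->
  (forall m i, 9 <= m <= 12 -> s m i = 0) -> 0 < n ->
  wp look fill s (fun k t => filled (fun _ _ _ => true) t /\ k <= 1000 * n ^ 2).
Proof.
move=> [s0 s3] ok zeros npos; have [z z0] := rank_onto npos.
pose Inv j t := filled (fun v' x' y' => r x' < j) t.
pose Phi j (_ : store) := (40 * n + 40) * (n - j) + 200 * n * edges_from (j * n).
apply: (wp_mono (@wp_for look 13 0 _ s n Inv Phi s0 _ _ _ _)) => //.
- split=> // v; first by rewrite /update /= zeros.
  (* The initial 0 in array 12 is the number of the vertex [z]. *)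
  by exists z; rewrite /update /= !zeros //; split; last left.
- move=> j t lt fr tj inv; have [x Ex] := rank_onto lt; rewrite {}Ex in tj lt inv *.
  have ixt : indexed t by split=> [|v]; rewrite fr.
  have okt : correct (fun _ _ => true) t by move=> u v _; rewrite !fr //; apply: ok.
  apply: (wp_mono (fill_row_spec ixt okt tj inv)) => k t' fr' [inv' le]; split.
    have : Inv (r x).+1 t'.
      apply: filled_sub inv' => v' x' y' _ _.
      by rewrite ltnS leq_eqVlt rank_eq orbC.
    by case=> *; split.
  rewrite /Phi [(r x).+1 * n]mulSnr.
  have -> : n - r x = (n - (r x).+1).+1 by lia.
  rewrite mulnS; move: (_ * (n - (r x).+1)) le => m.
   by move: (200 * n * _) (200 * n * _) => m1 m2; lia.
move=> k t fr [inv le]; split.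
  by apply: filled_sub inv => v x' y' _ _ _; apply: rank_lt.
move: le; rewrite /Phi mul0n /=; have := edges_from0; nia.
Qed.

(** The loops maintain that a certified pair is stored or none has been met; at the end
    [certified_ex] excludes the latter. *)
Lemma search_spec s (W A : V -> V -> nat) (B : V -> nat) (S : V -> V) : 0 < n ->
  indexed s -> correct (fun _ _ => true) s -> tables T W A B S ->
  (forall u v, s 9 (ix u v) = W u v) -> (forall u v, s 10 (ix u v) = A u v) ->
  (forall v, s 11 (r v) = B v) -> (forall v, s 12 (r v) = r (S v)) ->
  wp look search s (fun k t => (exists q y,
    [/\ t 1 0 = r q, t 2 0 = r y & certified T W A B S q y]) /\ k <= 300 * n ^ 2).
Proof.
move=> npos [s0 s3] ok tab s9 s10 s11 s12.
pose found (t : store) := exists q y,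
  [/\ t 1 0 = r q, t 2 0 = r y & certified T W A B S q y].
pose Inv i t := found t \/ forall q y, r q < i -> ~~ certified T W A B S q y.
pose Phi i (_ : store) := (200 * n + 40) * (n - i).
apply: (wp_mono (@wp_for look 13 0 _ s n Inv Phi s0 _ _ _ _)) => //.
- by right.
- move=> i t lt fr ti inv; have [q Eq] := rank_onto lt; rewrite {}Eq in ti lt inv *.
  have t0 : t 0 0 = n by rewrite fr.
  pose Inv2 j t := found t \/
    (forall x y, r x < r q -> ~~ certified T W A B S x y) /\
    (forall y, r y < j -> ~~ certified T W A B S q y).
  apply: (wp_mono (@wp_for look 14 0 _ t n Inv2 (fun j _ => 200 * (n - j)) t0 _ _ _ _)) => //.
  + by case: inv => [fnd|none]; [left | right].
  + move=> j t' lt' fr' t'j inv'.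
    have [y Ey] := rank_onto lt'; rewrite {}Ey in t'j lt' inv' *.
    have t'3 v : t' 3 (r v) = r v * n by rewrite fr' // fr // s3.
    have t'7 u v : t' 7 (ix u v) = dt u v by rewrite fr' // fr //; have [] := ok u v isT.
    have t'8 u v : t' 8 (ix u v) = dist u v.
      by rewrite fr' // fr //; have [] := ok u v isT.
    have t'9 u v : t' 9 (ix u v) = W u v by rewrite fr' // fr // s9.
    have t'10 u v : t' 10 (ix u v) = A u v by rewrite fr' // fr // s10.
    have t'11 v : t' 11 (r v) = B v by rewrite fr' // fr // s11.
    have t'12 v : t' 12 (r v) = r (S v) by rewrite fr' // fr // s12.
    have t'13 : t' 13 0 = r q by rewrite fr'.
    set guard := ESub one _.
    have gE : (eval look t' guard != 0) = certified T W A B S q y.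
      rewrite /= t'13 t'j t'12 !t'3 !t'11 !t'9 !t'10 !t'7 !t'8 /certified.
      lia.
    apply: wp_if => [/eqP|/eqP]; rewrite ?gE => cert.
      apply: (@wp_set_then _ _ _ _ 0 (r q)) => //.
      apply: (@wp_setE _ _ _ _ 0 (r y)) => //.
      split; last by move: lt'; rewrite /=; lia.
      by left; exists q, y.
    apply: wp_skip; split; last by move: lt'; rewrite /=; lia.
    case: inv' => [fnd|[none1 none2]]; [by left|right; split=> // z].
    rewrite ltnS leq_eqVlt => /predU1P[/rank_inj->|]; last exact: none2.
    by rewrite -gE cert.
  move=> k t' fr' [inv' le]; split; last by move: le lt; rewrite /Phi /=; nia.
  case: inv' => [fnd|[none1 none2]]; [by left|right => x y].
  rewrite ltnS leq_eqVlt => /predU1P[/rank_inj->|]; last exact: none1.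
  exact/none2/rank_lt.
move=> k t fr [inv le]; split; last by move: le; rewrite /Phi /=; nia.
case: inv => // none; have [q [y cert]] := certified_ex tree mono tab.
by rewrite (negPf (none q y (rank_lt q))) in cert.
Qed.

End Correctness.

Lemma nash_program_correct (V : finType) (T : temporal_graph V) (look : nat -> nat -> nat) :
  temporal_tree T -> monotonically_growing T -> lookup_table T look ->
  exists k s p1 p2,
    [/\ exec look nash_program (init_store #|V|) k s, k <= 2000 * #|V| ^ 2,
        outputs s p1 p2 & nash_equilibrium T p1 p2].
Proof.
move=> tree mono lookup; have [npos _ _] := tree.
have [n nE] : exists n, n = #|V| by exists #|V|.
rewrite -nE in npos *.
suff : wp look nash_program (init_store n) (fun k s => (exists q y,
    [/\ s 1 0 = rank q, s 2 0 = rank y & nash_equilibrium T q y]) /\ k <= 2000 * n ^ 2).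
  by move=> [k [s [ex [[q [y [s1 s2 ne]]] le]]]]; exists k, s, q, y.
apply: wp_seq; apply: (wp_mono (@rows_spec _ look _ nE (init_store n) erefl erefl)) => k1 t1 f1 [ix1 le1].
apply: wp_seq; apply: (wp_mono (bfs_spec tree mono lookup nE npos ix1 _ _ _ _)).
- by move=> i; rewrite f1.
- by move=> i; rewrite f1.
- by move=> i; rewrite f1.
- by move=> i; rewrite f1.
move=> k2 t2 f2 [ok2 le2].
have ix2 : indexed V n t2 by case: ix1 => t0 t3; split=> [|v]; rewrite f2.
apply: wp_seq; apply: (wp_mono (fill_spec tree mono lookup nE ix2 ok2 _ npos)).
  move=> m i m9; rewrite f2 ?f1 //; do 13?[case: m m9 => [|m] //= m9].
move=> k3 t3 f3 [fil le3].
have ix3 : indexed V n t3 by case: ix2 => t20 t23; split=> [|v]; rewrite f3.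
have ok3 : correct T n (fun _ _ => true) t3 by move=> u v _; rewrite !f3 //; apply: ok2.
have [S tS] := fin_all_exists (filled_best fil).
have tab : tables T (fun u v => t3 9 (rank u * n + rank v))
    (fun u v => t3 10 (rank u * n + rank v)) (fun v => t3 11 (rank v)) S.
  split=> [v x y||v]; [exact: (filled_edge fil) | exact: (filled_diag fil) |].
  by have [_] := tS v.
apply: (wp_mono (search_spec look tree mono nE npos ix3 ok3 tab _ _ _ _)) => //.
  by move=> v; have [] := tS v.
move=> k4 t4 _ [[q [y [t41 t42 cert]]] le4]; split.
  by exists q, y; split=> //; apply: certified_nash cert.
(* The phases sum to at most [9 + 23 * n + (600 + 1000 + 300) * n ^ 2], and [n] is positive. *)
by move: le1 le2 le3 le4; rewrite /=; nia.
Qed.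

Theorem theorem33 :
  (forall (V : finType) (T : temporal_graph V),
     temporal_tree T -> monotonically_growing T ->
     exists p1 p2 : V, nash_equilibrium T p1 p2) /\
  (exists (P : cmd) (C : nat),
     forall (V : finType) (T : temporal_graph V) (look : nat -> nat -> nat),
       temporal_tree T -> monotonically_growing T -> lookup_table T look ->
       exists (k : nat) (s : store) (p1 p2 : V),
         [/\ exec look P (init_store #|V|) k s,
             k <= C * #|V| ^ 2,
             outputs s p1 p2
           & nash_equilibrium T p1 p2]).
Proof.
split=> [V T tree mono|]; last first.
  by exists nash_program, 2000; exact: nash_program_correct.
(* Existence is read off from a run of the program on a lookup table built from [first_time]. *)
have [/card_gt0P[z _] _ _] := tree.
pose vtx := nth z (enum V).
pose look i j := if underlying T (vtx i) (vtx j) then first_time T (vtx i) (vtx j) else 0.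
have lookup : lookup_table T look.
  move=> u v; rewrite /look /vtx !nth_enum_rank.
  by case: (boolP (underlying T u v)) => [/first_timeP|].
have [_ [_ [p1 [p2 [_ _ _ ne]]]]] := nash_program_correct tree mono lookup.
by exists p1, p2.
Qed.
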